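(* Let $A\in\mathbb{C}^{N\times N}$ be such that $\frac12(A+I)+sI$ and $\frac12(A+2I)+sI$ are invertible for every integer $s\ge0$. Then the following relations between the Young's matrix functions $Y$ and the Bessel matrix functions $J$ hold: $$Y_A(x)=\sum_{k=0}^{\infty}\frac{1}{k!}(2x)^{\frac12(A+2kI)}\,x^{2k}\left(\tfrac12(A-I)\right)_k[(A+I)_{2k}]^{-1}\Gamma^{-1}(A+I)\,\Gamma\left(\tfrac12(A+(2k+2)I)\right)J_{\frac12(A+2kI)}(x),$$ $$Y_A(x)=\frac12\sum_{k=0}^{\infty}\frac{1}{k!}\left(\tfrac12A\right)_k[(A+I)_{2k}]^{-1}(2x)^{\frac12(A+(2k+1)I)}\Gamma^{-1}(A+I)\,\Gamma\left(\tfrac12(A+(2k+1)I)\right)J_{\frac12(A+(2k-1)I)}(x),$$ $$J_{\frac12A}(x)=\sum_{k=0}^{\infty}\frac{(-1)^k}{k!}(2x)^{-\frac12A}\left(\tfrac12(A-I)\right)_k[(A+I)_{2k}]^{-1}\Gamma^{-1}\left(\tfrac12(A+2I)\right)\Gamma(A+(2k+1)I)\,Y_{A+2kI}(x),$$ $$J_{\frac12(A-I)}(x)=2\sum_{k=0}^{\infty}\frac{(-1)^k}{k!}\left(\tfrac12A\right)_k(2x)^{-\frac12A}[(A+I)_{2k}]^{-1}\Gamma^{-1}\left(\tfrac12(A+I)\right)\Gamma(A+(2k+1)I)\,Y_{A+2kI}(x).$$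
   Context: $I$ is the $N\times N$ identity matrix; for $M\in\mathbb{C}^{N\times N}$, $(M)_0=I$ and $(M)_k=M(M+I)\cdots(M+(k-1)I)$ for $k\ge1$. $\Gamma(M)$ and $\Gamma^{-1}(M)$ (the reciprocal gamma function, which is entire, evaluated at $M$) are defined by the holomorphic matrix functional calculus, and $x^M=\exp(M\ln x)$. Young's matrix function is $$Y_A(x)=x^A\sum_{k=0}^\infty(-1)^k\,\Gamma^{-1}(A+(2k+1)I)\,x^{2k}=x^A\,\Gamma^{-1}(A+I)\,{}_1F_2\left(I;\tfrac12(A+I),\tfrac12(A+2I);-\tfrac{x^2}{4}\right),$$ where ${}_1F_2(P;B,C;w)=\sum_{k\ge0}\frac{w^k}{k!}(P)_k[(B)_k]^{-1}[(C)_k]^{-1}$. The Bessel matrix function is $$J_M(x)=\Gamma^{-1}(M+I)\left(\frac x2\right)^M{}_0F_1\left(-;M+I;-\frac{x^2}{4}\right),\qquad {}_0F_1(-;C;w)=\sum_{k\ge0}\frac{w^k}{k!}[(C)_k]^{-1}.$$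
   Formalization: Two formulas false as printed are corrected: in the first relation the extra factor x^{2k} is dropped (for A=0 it fails at order x^2), and in the fourth (2x)^{-A/2} is replaced by (2x)^{-(A+I)/2} (the printed sides differ by the factor (2x)^{1/2}). *)

(* Defs.v *)
From HB Require Import structures.
From mathcomp Require Import all_boot all_order all_algebra.
From mathcomp Require Import all_classical all_reals all_analysis.
From mathcomp Require Import complex.

Set Implicit Arguments.
Unset Strict Implicit.
Unset Printing Implicit Defensive.
Import Order.TTheory GRing.Theory Num.Theory.
Import numFieldNormedType.Exports.
Local Open Scope classical_set_scope.
Local Open Scope ring_scope.
Local Open Scope complex_scope.

(* The complex numbers packed as a numClosedFieldType: this gives cplx R, and
   matrices over it, the modulus topology that MathComp-Analysis puts on every
   such field but does not declare on the type R[i]. *)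
Definition cplx (R : realType) : numClosedFieldType := R[i].

Section ScalarFunctions.
Variable R : realType.
Implicit Types z : cplx R.

Definition cexp z : cplx R :=
  (expR (complex.Re z))%:C * (cos (complex.Im z) +i* sin (complex.Im z)).

(* Principal argument of z != 0, in ]-pi, pi]. *)
Definition carg z : R :=
  let t := acos (complex.Re z / Normc.normc z) in
  if 0 <= complex.Im z then t else - t.

Definition cln z : cplx R := ln (Normc.normc z) +i* carg z.

(* The reciprocal gamma function, by the Euler-Gauss limit
   1 / Gamma(z) = lim_n z (z + 1) ... (z + n) / (n! n^z). *)
Definition crGamma z : cplx R :=
  lim ((\prod_(j < n.+1) (z + j%:R)) / (n`!%:R * cexp (z * (ln n%:R)%:C))
       @[n --> \oo]).

(* The junk value 0^-1 = 0 is taken at the poles 0, -1, -2, etc. *)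
Definition cGamma z : cplx R := (crGamma z)^-1.

End ScalarFunctions.

Section MatrixFunctions.
Variables (K : numClosedFieldType) (n : nat).
Implicit Types (M B : 'M[K]_n.+1) (f : K -> K).

(* Holomorphic functional calculus: f(M) = p(M) for any polynomial p such that
   p^(j)(z) = f^(j)(z) at every eigenvalue z of M and every j smaller than the
   multiplicity of z in the minimal polynomial of M (mup is 0 off the
   spectrum).  Such a p always exists, and p(M) does not depend on its choice;
   f is meant to be holomorphic on a neighbourhood of the spectrum of M. *)
Definition hermite_interpolates f M (p : {poly K}) : Prop :=
  forall (z : K) (j : nat), (j < mup z (mxminpoly M))%N ->
    (p^`(j)%R).[z] = derive1n j f z.

Definition mxfun f M : 'M[K]_n.+1 :=
  horner_mx M (xget 0 [set p | hermite_interpolates f M p]).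

Definition mxexp M : 'M[K]_n.+1 :=
  lim (series (fun k => (k`!%:R)^-1 *: M ^+ k) @ \oo).

Definition mxpoch M (k : nat) : 'M[K]_n.+1 := \prod_(j < k) (M + j%:R%:M).

Definition hyp0F1 B (w : K) : 'M[K]_n.+1 :=
  lim (series (fun k => (w ^+ k / k`!%:R) *: (mxpoch B k)^-1) @ \oo).

End MatrixFunctions.

Section SpecialFunctions.
Variables (R : realType) (n : nat).
Implicit Types (M A : 'M[cplx R]_n.+1) (x : cplx R).

Definition mxGamma M : 'M[cplx R]_n.+1 := mxfun (@cGamma R) M.

Definition mxrGamma M : 'M[cplx R]_n.+1 := mxfun (@crGamma R) M.

Definition mxpow x M : 'M[cplx R]_n.+1 := mxexp (cln x *: M).

Definition young A x : 'M[cplx R]_n.+1 :=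
  mxpow x A *
  lim (series (fun k =>
    ((-1) ^+ k * x ^+ (2 * k)) *: mxrGamma (A + (2 * k + 1)%:R%:M))
    @ \oo).

Definition bessel M x : 'M[cplx R]_n.+1 :=
  mxrGamma (M + 1%:M) * mxpow (x / 2) M *
  hyp0F1 (M + 1%:M) (- (x ^+ 2 / 4)).

End SpecialFunctions.

(* Main.v *)
Require Import Defs.
From HB Require Import structures.
From mathcomp Require Import all_boot all_order all_algebra.
From mathcomp Require Import all_classical all_reals all_analysis.
From mathcomp Require Import complex ring lra zify.

(** * Relations between Young's matrix functions and Bessel matrix functions

    Put w = - x^2 / 4, B = (A + I) / 2 and C = (A + 2I) / 2.  The functional
    equation of the reciprocal gamma function gives
    rGamma(A + (2k+1)I) = [(A+I)_2k]^-1 rGamma(A+I), and (A+I)_2k factors as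
    4^k (B)_k (C)_k, so that Young's function is x^A rGamma(A+I) times
    1F2(I; B, C; w) = sum_k w^k [(B)_k]^-1 [(C)_k]^-1 (lemma youngE).

    In the k-th term of each of the four series the value of Gamma cancels a
    value of rGamma (mxrGammaK), the powers of 2x, x/2 and x combine into x^2k
    times a power that does not depend on k (powers_term1 to powers_term4), and
    what is left (term1 to term4) is one of the two expansions

      1F2(I; B, C; w) =
        sum_k (-w)^k / k! (B-I)_k [(B)_k]^-1 [(C)_k]^-1 0F1(-; C+kI; w),
      0F1(-; C; w) =
        sum_k w^k / k! (B-I)_k [(B)_k]^-1 [(C)_k]^-1 1F2(I; B+kI, C+kI; w)

    or one of them with B and C exchanged (hyp1F2_expansion, hyp0F1_expansion).
    Each is the interchange of an absolutely convergent double sum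
    (double_series): the inverse Pochhammer products decay faster than any
    geometric sequence (mnm_poch_inv), and the coefficients of w^m agree because
    sum_k (-1)^k binom(m,k) (B-I)_k [(B)_k]^-1 = m! [(B)_m]^-1 (Chu-Vandermonde,
    sum_poch_ratio) and sum_(k <= m) (B-I)_k / k! = (B)_m / m! (sum_poch_fact).

    Two analytic facts make the manipulation of gamma matrices legitimate.
    First, the Euler-Gauss limit that defines the scalar function rGamma
    converges to the sum of an everywhere convergent power series
    (crGamma_smooth), satisfies rGamma(z) = z rGamma(z+1) (crGamma_shift), and
    vanishes at no point outside 0, -1, -2, ... (crGamma_neq0).  The proof works
    with coefficient sequences: the quotient of two consecutive approximants is
    1 + u with u of size O(1/n^2) in every weighted l1 norm, and these norms are
    submultiplicative for the Cauchy product, so the coefficients converge with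
    uniform bounds.  Second, the holomorphic
    functional calculus is multiplicative (mxfunM): Hermite interpolants exist,
    f(M) does not depend on the chosen one, and a product of interpolants
    interpolates the product of the functions by Leibniz' rule, which requires
    the functions to have derivatives of all orders near the spectrum.

    All matrices involved commute, since each commutes with whatever commutes
    with A (bicomm). *)

Set Implicit Arguments.
Unset Strict Implicit.
Unset Printing Implicit Defensive.
Import Order.TTheory GRing.Theory Num.Theory.
Import numFieldNormedType.Exports.
Local Open Scope classical_set_scope.
Local Open Scope ring_scope.
Local Open Scope complex_scope.

(** * Real-valued norms and absolute convergence *)

Section RealNorm.
Variable R : realType.
Local Notation K := (cplx R).

(** The norm of a normed module over the complex numbers takes its values in the
    complex numbers; its real part allows real arithmetic on bounds. *)
Definition nm (V : normedModType K) (v : V) : R := complex.Re `|v|.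

Lemma nmE (V : normedModType K) (v : V) : `|v| = (nm v)%:C.
Proof.
have := normr_ge0 v; rewrite /nm; case: `|v| => a b.
by rewrite lecE /= => /andP[/eqP-> _].
Qed.

Lemma nm_ge0 (V : normedModType K) (v : V) : 0 <= nm v.
Proof. by have := normr_ge0 v; rewrite nmE -(ler0c (nm v)). Qed.

Lemma nm_le (V W : normedModType K) (v : V) (w : W) :
  (`|v| <= `|w|) = (nm v <= nm w).
Proof. by rewrite !nmE lecR. Qed.

Lemma nmD (V : normedModType K) (v w : V) : nm (v + w) <= nm v + nm w.
Proof. by rewrite -lecR -nmE rmorphD /= -!nmE ler_normD. Qed.

Lemma nmN (V : normedModType K) (v : V) : nm (- v) = nm v.
Proof. by rewrite /nm normrN. Qed.

Lemma nm0 (V : normedModType K) : nm (0 : V) = 0.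
Proof. by rewrite /nm normr0. Qed.

Lemma nm_eq0 (V : normedModType K) (v : V) : nm v = 0 -> v = 0.
Proof. by move=> v0; apply/eqP; rewrite -normr_eq0 nmE v0. Qed.

Lemma nmZ (V : normedModType K) (a : K) (v : V) : nm (a *: v) = nm a * nm v.
Proof. by apply: complexI; rewrite rmorphM /= -!nmE normrZ. Qed.

Lemma nmM (a b : K) : nm (a * b) = nm a * nm b.
Proof. by apply: complexI; rewrite rmorphM /= -!nmE normrM. Qed.

Lemma nm1 : nm (1 : K) = 1.
Proof. by rewrite /nm normr1. Qed.

Lemma nmV (a : K) : nm a^-1 = (nm a)^-1.
Proof. by apply: complexI; rewrite fmorphV /= -!nmE normfV. Qed.

Lemma nmX (a : K) k : nm (a ^+ k) = nm a ^+ k.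
Proof. by elim: k => [|k IH]; rewrite ?nm1 // !exprS nmM IH. Qed.

Lemma nm_nat k : nm (k%:R : K) = k%:R.
Proof. by rewrite /nm normr_nat raddfMn. Qed.

Lemma nmC (a : R) : nm (a%:C : K) = `|a|.
Proof. by apply: complexI; rewrite -nmE normc_def /= expr0n /= addr0 sqrtr_sqr. Qed.

Lemma nm_normc (a : K) : nm a = Normc.normc a.
Proof. by []. Qed.

Lemma nm_sum (V : normedModType K) (I : Type) (r : seq I) (P : pred I)
    (F : I -> V) :
  nm (\sum_(i <- r | P i) F i) <= \sum_(i <- r | P i) nm (F i).
Proof.
elim/big_rec2: _ => [|i y x _ xy]; first by rewrite nm0.
by apply: le_trans (nmD _ _) _; rewrite lerD2l.
Qed.

Lemma nm_distC (V : normedModType K) (v w : V) : nm (v - w) = nm (w - v).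
Proof. by rewrite -nmN opprB. Qed.

Lemma nm_cvgP (V : normedModType K) (u : V^nat) (l : V) :
  (u @ \oo --> l) <->
  (forall e : R, 0 < e -> \forall n \near \oo, nm (l - u n) < e).
Proof.
split=> [/cvgrPdist_lt ul e e0|ul].
  have e0' : 0 < (e%:C : K) by rewrite ltcR.
  by have := ul _ e0'; apply: filterS => n /=; rewrite nmE ltcR.
apply/cvgrPdist_lt => e; case: e => a b; rewrite ltcE /= => /andP[/eqP-> a0].
by have := ul _ a0; apply: filterS => n /=; rewrite nmE ltcR.
Qed.

Lemma nm_squeeze (V : normedModType K) (u : V^nat) (l : V) (e : R^nat) :
  (\forall n \near \oo, nm (l - u n) <= e n) -> e @ \oo --> (0 : R) ->
  u @ \oo --> l.
Proof.
move=> ue e0; apply/nm_cvgP => d d0.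
move/cvgrPdist_lt : e0 => /(_ _ d0) e0.
near=> n; have : `|0 - e n| < d by near: n.
rewrite sub0r normrN; apply: le_lt_trans; apply: le_trans (ler_norm _).
by near: n.
Unshelve. all: by end_near. Qed.

Lemma cvg_nm (V : normedModType K) (u : V^nat) (l : V) :
  u @ \oo --> l -> nm (u n) @[n --> \oo] --> nm l.
Proof.
move=> /nm_cvgP ul; apply/cvgrPdist_lt => e e0.
have := ul _ e0; apply: filterS => n; apply: le_lt_trans.
rewrite ler_norml; apply/andP; split.
  have := nmD (u n - l) l; rewrite subrK nm_distC; lra.
have := nmD (l - u n) (u n); rewrite subrK; lra.
Qed.

Lemma nm_lim_le (V : normedModType K) (u : V^nat) (l : V) (D : R) :
  u @ \oo --> l -> (\forall n \near \oo, nm (u n) <= D) -> nm l <= D.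
Proof.
move=> /cvg_nm ul uD; have -> : nm l = lim (nm (u n) @[n --> \oo]).
  by apply/esym/cvg_lim => //; exact: Rhausdorff.
by apply: limr_le => //; apply/cvg_ex; exists (nm l).
Qed.

(** Absolutely convergent series converge; a bound on the partial sums of norms
    is the form in which absolute convergence is always available below. *)
Definition abs_complete (V : normedModType K) := forall (u : V^nat) (D : R),
  (forall n, \sum_(k < n) nm (u k) <= D) -> cvg (series u @ \oo).

Lemma nm_Re (a : K) : `|complex.Re a| <= nm a.
Proof. by rewrite -lecR -nmE; case: a => a b; exact: normc_ge_Re. Qed.

Lemma nm_Im (a : K) : `|complex.Im a| <= nm a.
Proof.
have := nm_Re (- 'i * a); rewrite nmM nmN; case: a => a b.
have -> : nm ('i : K) = 1 by rewrite /nm normCi.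
by rewrite mul1r /=; simpc.
Qed.

Lemma nm_ReIm (a : K) : nm a <= `|complex.Re a| + `|complex.Im a|.
Proof.
have -> : a = (complex.Re a)%:C + 'i%C * (complex.Im a)%:C :> K.
  by case: a => a b; simpc.
apply: le_trans (nmD _ _) _; rewrite nmM.
have -> : nm ('i%C : K) = 1 by rewrite /nm normCi.
by rewrite mul1r !nmC; case: a => a b /=; rewrite !(mul0r, mulr0, mul1r, subr0, add0r, addr0).
Qed.

Lemma cvg_complex (u : K^nat) (a b : R) :
  complex.Re (u n) @[n --> \oo] --> a -> complex.Im (u n) @[n --> \oo] --> b ->
  u @ \oo --> (a +i* b : K).
Proof.
move=> ua ub.
apply: (@nm_squeeze _ _ _ (fun n => `|a - complex.Re (u n)| + `|b - complex.Im (u n)|)).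
  near=> n; apply: le_trans (nm_ReIm _) _.
  by case: (u n).
have -> : (0 : R) = `|a - a| + `|b - b| by rewrite !subrr normr0 addr0.
by apply: cvgD; apply: cvg_norm; apply: cvgB => //; apply: cvg_cst.
Unshelve. all: by end_near. Qed.

(** Real and imaginary parts are dominated by the modulus, so both real series
    converge absolutely. *)
Lemma complex_abs_complete : abs_complete K.
Proof.
move=> u D uD.
have aux (f : K -> R) : (forall a b, f (a + b) = f a + f b) -> f 0 = 0 ->
    (forall a, `|f a| <= nm a) -> cvg (f (series u n) @[n --> \oo]).
  move=> fD f0 fle.
  have -> : (fun n => f (series u n)) = series (fun n => f (u n)).
    by apply/funext => n; rewrite /series /= (big_morph f fD f0).
  apply: normed_cvg; apply: nondecreasing_is_cvgn.
    by apply: nondecreasing_series => n _ _; exact: normr_ge0.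
  exists D => _ [n _ <-]; apply: le_trans (uD n).
  rewrite /normed_series_of /series /= big_mkord; apply: ler_sum => i _; exact: fle.
have /cvg_ex[a ua] := aux (@complex.Re R) (fun a b => raddfD _ a b) (raddf0 _) nm_Re.
have /cvg_ex[b ub] := aux (@complex.Im R) (fun a b => raddfD _ a b) (raddf0 _) nm_Im.
by apply/cvg_ex; exists (a +i* b); exact: cvg_complex.
Qed.

Lemma nm_mx_entry m n (M : 'M[K]_(m, n)) i j : nm (M i j) <= nm M.
Proof.
rewrite -nm_le [leRHS]/Num.Def.normr /= mx_normE.
rewrite -[leLHS]nngE num_le; exact: (le_bigmax _ (fun x => `|M x.1 x.2|%:nng) (i, j)).
Qed.

Lemma nm_mx_le m n (M : 'M[K]_(m, n)) (e : R) : 0 <= e ->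
  (forall i j, nm (M i j) <= e) -> nm M <= e.
Proof.
move=> e0 Me; rewrite -lecR -nmE /Num.Def.normr /= mx_normE.
have e0' : 0 <= (e%:C : K) by rewrite ler0c.
rewrite -[leRHS]/((NngNum e0')%:num) num_le; apply/bigmax_leP; split.
  by rewrite -num_le /=.
by move=> [i j] _; rewrite -num_le /= nmE lecR Me.
Qed.

Lemma cvg_mx_entries m n (u : nat -> 'M[K]_(m, n)) (l : 'M[K]_(m, n)) :
  (forall i j, u k i j @[k --> \oo] --> l i j) -> u @ \oo --> l.
Proof.
move=> ul; apply/nm_cvgP => e e0.
have e20 : 0 < e / 2 by rewrite divr_gt0.
have H : \forall k \near \oo, forall i j, nm (l i j - u k i j) < e / 2.
  apply: filter_forall => i; apply: filter_forall => j.
  by have /nm_cvgP := ul i j; apply.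
apply: filterS H => k H; apply: (@le_lt_trans _ _ (e / 2)); last by lra.
by apply: nm_mx_le => [|i j]; rewrite ?ltW // !mxE H.
Qed.

Lemma mx_abs_complete m n : abs_complete 'M[K]_(m, n).
Proof.
move=> u D uD.
have H i j : cvg (series (fun k => u k i j) @ \oo).
  apply: (complex_abs_complete (D := D)) => k; apply: le_trans (uD k).
  by apply: ler_sum => p _; exact: nm_mx_entry.
apply/cvg_ex; exists (\matrix_(i, j) lim (series (fun k => u k i j) @ \oo)).
apply: cvg_mx_entries => i j; rewrite mxE.
have -> : (fun k => series u k i j) = series (fun k => u k i j).
  by apply/funext => k; rewrite /series /= summxE.
exact: H.
Qed.

Lemma nm_mulmx m n p (A : 'M[K]_(m, n)) (B : 'M[K]_(n, p)) :
  nm (A *m B) <= n%:R * (nm A * nm B).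
Proof.
apply: nm_mx_le => [|i j]; first by rewrite !mulr_ge0 ?nm_ge0.
rewrite mxE; apply: le_trans (nm_sum _ _ _) _.
have -> : n%:R * (nm A * nm B) = \sum_(k < n) (nm A * nm B).
  by rewrite sumr_const card_ord mulr_natl.
by apply: ler_sum => k _; rewrite nmM ler_pM ?nm_ge0 ?nm_mx_entry.
Qed.

End RealNorm.

(** * Interchange of double series *)

Section DoubleSeries.
Variable R : realType.
Local Notation K := (cplx R).

Lemma half_sum_le n : \sum_(k < n) (2^-1 : R) ^+ k <= 2.
Proof.
suff -> : \sum_(k < n) (2^-1 : R) ^+ k = 2 - 2 * 2^-1 ^+ n.
  by rewrite gerBl mulr_ge0 // exprn_ge0 // invr_ge0.
elim: n => [|n IH]; first by rewrite big_ord0 expr0; lra.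
by rewrite big_ord_recr /= IH exprS; field.
Qed.

(** Bernoulli's inequality gives n <= 2 (3/2)^n, hence n / 2^n <= 2 (3/4)^n. *)
Lemma nat_half_pow_cvg0 (D : R) : (n%:R * (D * 2^-1 ^+ n)) @[n --> \oo] --> (0 : R).
Proof.
have g : geometric (2 * `|D|) (3 / 4 : R) n @[n --> \oo] --> (0 : R).
  by apply: cvg_geometric; rewrite gtr0_norm; lra.
have bern k : k%:R <= 2 * (3 / 2 : R) ^+ k.
  elim: k => [|k IH]; first by rewrite expr0; lra.
  have : 1 <= (3 / 2 : R) ^+ k by rewrite exprn_ege1 //; lra.
  by rewrite exprS -[k.+1%:R]natr1; lra.
apply/cvgrPdist_lt => e e0; move/cvgrPdist_lt : g => /(_ _ e0).
apply: filterS => n; rewrite !sub0r !normrN /geometric /=; apply: le_lt_trans.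
rewrite !normrM normr_nat normr_id !(ger0_norm (x := _ ^+ _)) ?exprn_ge0 //; try lra.
rewrite [`|2|]ger0_norm //.
have -> : (3 / 4 : R) = (3 / 2) * 2^-1 by lra.
rewrite exprMn.
have h0 : 0 <= (2^-1 : R) ^+ n by rewrite exprn_ge0 // invr_ge0.
have := bern n; have := normr_ge0 D => D0 bn.
have : `|D| * (2^-1 ^+ n) * n%:R <= `|D| * (2^-1 ^+ n) * (2 * (3 / 2 : R) ^+ n).
  by rewrite ler_wpM2l // mulr_ge0.
lra.
Qed.

Variable V : normedModType K.
Hypothesis bV : abs_complete V.

Lemma geo_cvg (u : V^nat) (D : R) :
  (forall k, nm (u k) <= D * 2^-1 ^+ k) -> cvg (series u @ \oo).
Proof.
move=> uD; have D0 : 0 <= D.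
  by have := uD 0%N; rewrite expr0 mulr1; apply: le_trans; exact: nm_ge0.
apply: (bV (D := D * 2)) => n.
apply: le_trans (_ : \sum_(k < n) D * 2^-1 ^+ k <= _); first exact: ler_sum.
by rewrite -mulr_sumr ler_wpM2l // half_sum_le.
Qed.

(** The remainder of a geometrically dominated series is dominated by the first
    omitted bound; used to replace full row sums by truncated ones. *)
Lemma geo_tail (u : V^nat) (D : R) (l : V) n :
  (forall k, nm (u k) <= D * 2^-1 ^+ k) -> series u @ \oo --> l ->
  nm (l - series u n) <= 2 * D * 2^-1 ^+ n.
Proof.
move=> uD ul; have D0 : 0 <= D.
  by have := uD 0%N; rewrite expr0 mulr1; apply: le_trans; exact: nm_ge0.
apply: (@nm_lim_le _ _ (fun m => series u m - series u n)).
  by apply: cvgB => //; exact: cvg_cst.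
near=> m; have lnm : (n <= m)%N by near: m; exact: nbhs_infty_ge.
rewrite /series /= (big_cat_nat (n := n)) //= [X in nm X]addrAC subrr add0r.
apply: le_trans (nm_sum _ _ _) _.
rewrite -{1}[n]add0n big_addn big_mkord.
apply: le_trans (_ : \sum_(k < m - n) (D * 2^-1 ^+ n) * 2^-1 ^+ k <= _).
  by apply: ler_sum => k _; rewrite -mulrA -exprD addnC; exact: uD.
rewrite -mulr_sumr; have := half_sum_le (m - n).
have : 0 <= D * 2^-1 ^+ n by rewrite mulr_ge0 // exprn_ge0 // invr_ge0.
by move=> h1 h2; have := ler_wpM2l h1 h2; lra.
Unshelve. all: by end_near. Qed.

Lemma triangle_sum (W : zmodType) (a : nat -> nat -> W) N :
  \sum_(n < N) \sum_(k < n.+1) a k (n - k)%N =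
  \sum_(k < N) \sum_(m < N - k) a k m.
Proof.
elim: N => [|N IH]; first by rewrite !big_ord0.
rewrite big_ord_recr /= IH [RHS]big_ord_recr /= subSnn big_ord1.
rewrite [X in _ + X]big_ord_recr /= subnn addrA -big_split /=; congr (_ + _).
by apply: eq_bigr => k _; rewrite subSn ?big_ord_recr // ltnW.
Qed.

(** Summing the antidiagonals up to N covers the triangle k + m < N, which
    differs from the first N full rows by the tails of N rows, each at most
    2 D / 2^N; the total error N 2 D / 2^N vanishes. *)
Lemma double_series (a : nat -> nat -> V) (S : V^nat) (D : R) (L : V) :
  (forall k m, nm (a k m) <= D * 2^-1 ^+ (k + m)) ->
  (forall k, series (a k) @ \oo --> S k) ->
  series (fun n => \sum_(k < n.+1) a k (n - k)%N) @ \oo --> L ->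
  series S @ \oo --> L.
Proof.
move=> aD aS dL.
have h : series S n - series (fun n => \sum_(k < n.+1) a k (n - k)%N) n
    @[n --> \oo] --> (0 : V).
  apply: (nm_squeeze (e := fun n => n%:R * ((2 * D) * 2^-1 ^+ n))); last first.
    exact: nat_half_pow_cvg0.
  near=> n; rewrite sub0r nmN /series /= !big_mkord triangle_sum -sumrB.
  apply: le_trans (nm_sum _ _ _) _.
  apply: le_trans (_ : \sum_(k < n) ((2 * D) * 2^-1 ^+ n) <= _); last first.
    by rewrite sumr_const card_ord (mulr_natl _ n).
  apply: ler_sum => k _.
  have := @geo_tail (a k) (D * 2^-1 ^+ k) (S k) (n - k)%N _ (aS k).
  rewrite /series /= big_mkord => /(_ _)/le_trans; apply.
    by move=> m; rewrite -mulrA -exprD.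
  by rewrite mulrA -mulrA -exprD subnKC // ltnW.
have -> : L = 0 + L by rewrite add0r.
rewrite (_ : series S = (fun n => series S n - series (fun n => \sum_(k < n.+1) a k (n - k)%N) n
   + series (fun n => \sum_(k < n.+1) a k (n - k)%N) n)); last first.
  by apply/funext => n; rewrite subrK.
exact: cvgD.
Unshelve. all: by end_near. Qed.

End DoubleSeries.

(** * Limits of matrix products *)

Section MatrixLimits.
Variables (R : realType) (n : nat).
Local Notation K := (cplx R).
Implicit Types (u : nat -> 'M[K]_n.+1) (A B M l : 'M[K]_n.+1).

(** The norm of a matrix is the largest modulus of an entry, which is
    submultiplicative only up to the factor n+1; this rescaling absorbs it. *)
Definition mnm M : R := n.+1%:R * nm M.

Lemma mnm_ge0 M : 0 <= mnm M.
Proof. by rewrite mulr_ge0 ?nm_ge0. Qed.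

Lemma nm_mnm M : nm M <= mnm M.
Proof. by rewrite ler_peMl ?nm_ge0 // ler1n. Qed.

Lemma mnmM A B : mnm (A * B) <= mnm A * mnm B.
Proof. by rewrite /mnm -mulrA ler_wpM2l // mulrCA nm_mulmx. Qed.

Lemma mnmD A B : mnm (A + B) <= mnm A + mnm B.
Proof. by rewrite -mulrDr ler_wpM2l // nmD. Qed.

Lemma mnmN A : mnm (- A) = mnm A.
Proof. by rewrite /mnm nmN. Qed.

Lemma mnmZ (c : K) A : mnm (c *: A) = nm c * mnm A.
Proof. by rewrite /mnm nmZ mulrCA. Qed.

Lemma mnm_scalar (c : K) : mnm c%:M = mnm 1 * nm c.
Proof. by rewrite -scalemx1 mnmZ mulrC. Qed.

Lemma cvg_mulmxl A u l : u @ \oo --> l -> A * u k @[k --> \oo] --> A * l.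
Proof.
move=> ul; apply: (nm_squeeze (e := fun k => mnm A * (n.+1%:R * nm (l - u k)))).
  by near=> k; rewrite -mulrBr; apply: le_trans (nm_mnm _) (mnmM _ _).
rewrite [X in _ --> X](_ : 0 = mnm A * (n.+1%:R * nm (l - l))); last first.
  by rewrite subrr nm0 !mulr0.
apply: cvgMl_tmp; apply: cvgMl_tmp; apply: cvg_nm.
by apply: cvgB => //; apply: cvg_cst.
Unshelve. all: by end_near. Qed.

Lemma cvg_mulmxr A u l : u @ \oo --> l -> u k * A @[k --> \oo] --> l * A.
Proof.
move=> ul; apply: (nm_squeeze (e := fun k => n.+1%:R * nm (l - u k) * mnm A)).
  by near=> k; rewrite -mulrBl; apply: le_trans (nm_mnm _) (mnmM _ _).
rewrite [X in _ --> X](_ : 0 = n.+1%:R * nm (l - l) * mnm A); last first.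
  by rewrite subrr nm0 mulr0 mul0r.
apply: cvgMr_tmp; apply: cvgMl_tmp; apply: cvg_nm.
by apply: cvgB => //; apply: cvg_cst.
Unshelve. all: by end_near. Qed.

Lemma cvg_series_mulmxl A u l :
  series u @ \oo --> l -> series (fun k => A * u k) @ \oo --> A * l.
Proof.
move=> ul; rewrite (_ : series _ = fun k => A * series u k).
  exact: cvg_mulmxl.
by apply/funext => k; rewrite /series /= mulr_sumr.
Qed.

Lemma cvg_series_mulmxr A u l :
  series u @ \oo --> l -> series (fun k => u k * A) @ \oo --> l * A.
Proof.
move=> ul; rewrite (_ : series _ = fun k => series u k * A).
  exact: cvg_mulmxr.
by apply/funext => k; rewrite /series /= mulr_suml.
Qed.

Lemma comm_lim A u l :
  (forall k, GRing.comm A (u k)) -> u @ \oo --> l -> GRing.comm A l.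
Proof.
move=> Au ul; apply: (@cvg_unique _ _ (A * u k @[k --> \oo])).
- exact: norm_hausdorff.
- exact: cvg_mulmxl.
- by rewrite (_ : (fun k => _) = (fun k => u k * A)); [exact: cvg_mulmxr|apply/funext].
Qed.

End MatrixLimits.

(** * The complex exponential and logarithm *)

Section ComplexExponential.
Variable R : realType.
Local Notation K := (cplx R).

(** r^k / k! = (2r)^k / k! / 2^k, and (2r)^k / k! is one term of exp(2r). *)
Lemma exp_coeff_geo (r : R) : 0 <= r ->
  exists D : R, forall k, r ^+ k / k`!%:R <= D * 2^-1 ^+ k.
Proof.
move=> r0; exists (expR (2 * r)) => k.
have r20 : 0 <= 2 * r by rewrite mulr_ge0.
rewrite exprVn ler_pdivlMr ?exprn_gt0 // mulrAC -exprMn [r * 2]mulrC.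
have : series (exp_coeff (2 * r)) k.+1 <= expR (2 * r).
  apply: nondecreasing_cvgn_le; last exact: is_cvg_series_exp_coeff.
  by apply: nondecreasing_series => i _ _; exact: exp_coeff_ge0.
apply: le_trans; rewrite /series /= big_nat_recr //= lerDr sumr_ge0 // => i _.
exact: exp_coeff_ge0.
Qed.

Lemma exp_sum_le (r : R) n : 0 <= r ->
  \sum_(k < n) r ^+ k / k`!%:R <= expR r.
Proof.
move=> r0; suff : series (exp_coeff r) n <= expR r by rewrite /series /= big_mkord.
apply: nondecreasing_cvgn_le; last exact: is_cvg_series_exp_coeff.
by apply: nondecreasing_series => i _ _; exact: exp_coeff_ge0.
Qed.

Lemma exp_binomial (x y : K) n :
  \sum_(k < n.+1) (x ^+ k / k`!%:R) * (y ^+ (n - k) / (n - k)`!%:R) =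
  (x + y) ^+ n / n`!%:R.
Proof.
rewrite addrC exprDn mulr_suml; apply: eq_bigr => k _.
have kn : (k <= n)%N by rewrite -ltnS.
rewrite -(bin_fact kn) !natrM -mulr_natr.
have f0 m : (m`!%:R : K) != 0 by rewrite pnatr_eq0 -lt0n fact_gt0.
have b0 : ('C(n, k)%:R : K) != 0 by rewrite pnatr_eq0 -lt0n bin_gt0.
by field; rewrite !f0 b0.
Qed.

Lemma cvg_mulcl (a : K) (u : K^nat) (l : K) :
  u @ \oo --> l -> (fun n => a * u n) @ \oo --> a * l.
Proof. move=> ul; exact: (@cvgMl_tmp K nat _ _ u a l ul). Qed.

Lemma cvg_mulcr (a : K) (u : K^nat) (l : K) :
  u @ \oo --> l -> (fun n => u n * a) @ \oo --> l * a.
Proof. move=> ul; exact: (@cvgMr_tmp K nat _ _ u l a ul). Qed.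

Lemma cauchy_product (u v : K^nat) (Da Db : R) (U V L : K) :
  (forall k, nm (u k) <= Da * 2^-1 ^+ k) ->
  (forall k, nm (v k) <= Db * 2^-1 ^+ k) ->
  series u @ \oo --> U -> series v @ \oo --> V ->
  series (fun n => \sum_(k < n.+1) u k * v (n - k)%N) @ \oo --> L -> L = U * V.
Proof.
move=> uD vD uU vV dL.
have S1 : series (fun k => u k * V) @ \oo --> L.
  apply: (double_series (a := fun k m => u k * v m) (D := Da * Db)) dL.
    move=> k m; rewrite nmM exprD mulrACA.
    by apply: ler_pM; [exact: nm_ge0|exact: nm_ge0|exact: uD|exact: vD].
  move=> k; rewrite (_ : series _ = fun n => u k * series v n).
    by apply: cvg_mulcl; exact: vV.
  by apply/funext => n; rewrite /series /= mulr_sumr.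
have S2 : series (fun k => u k * V) @ \oo --> U * V.
  rewrite (_ : series _ = fun n => series u n * V).
    by apply: cvg_mulcr; exact: uU.
  by apply/funext => n; rewrite /series /= mulr_suml.
by apply: (cvg_unique _ S1 S2); exact: norm_hausdorff.
Qed.

(** For z = a + ib the series of exp(a) and of cos b + i sin b are summed
    separately, by the definitions of the real functions, and multiplied. *)
Lemma cexp_series (z : K) : series (fun k => z ^+ k / k`!%:R) @ \oo --> cexp z.
Proof.
case: z => a b.
pose u k : K := (a%:C : K) ^+ k / k`!%:R.
pose v k : K := ('i%C * b%:C : K) ^+ k / k`!%:R.
have [Da uD] : exists D, forall k, nm (u k) <= D * 2^-1 ^+ k.
  have [D h] := exp_coeff_geo (normr_ge0 a); exists D => k.
  by rewrite nmM nmV nm_nat nmX nmC.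
have [Db vD] : exists D, forall k, nm (v k) <= D * 2^-1 ^+ k.
  have [D h] := exp_coeff_geo (normr_ge0 b); exists D => k.
  rewrite nmM nmV nm_nat nmX nmM nmC.
  by have -> : nm ('i%C : K) = 1; rewrite ?mul1r // /nm normCi.
have ua : series u @ \oo --> ((expR a)%:C : K).
  apply: cvg_complex.
    have -> : (fun n => complex.Re (series u n)) = series (exp_coeff a).
      apply/funext => n; rewrite /series /= raddf_sum; apply: eq_bigr => k _ /=.
      have -> : u k = (exp_coeff a k)%:C.
        by rewrite /u /exp_coeff /= rmorphM fmorphV rmorphXn /= rmorph_nat.
      by [].
    exact: is_cvg_series_exp_coeff.
  have -> : (fun n => complex.Im (series u n)) = (fun=> 0).
    apply/funext => n; rewrite /series /= raddf_sum big1 // => k _ /=.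
    have -> : u k = (exp_coeff a k)%:C.
      by rewrite /u /exp_coeff /= rmorphM fmorphV rmorphXn /= rmorph_nat.
    by [].
  exact: cvg_cst.
have vE k : v k = cos_coeff b k +i* sin_coeff b k.
  rewrite /v exprMn.
  have -> : ('i%C : K) ^+ k = (-1) ^+ k./2 * 'i%C ^+ (odd k).
    by rewrite -{1}(odd_double_half k) addnC exprD -mul2n exprM sqr_i.
  rewrite /cos_coeff /sin_coeff /=.
  have -> : (-1 : R) ^ k./2 = (-1) ^+ k./2 by [].
  have -> : (-1 : K) ^+ k./2 = ((-1) ^+ k./2)%:C by rewrite rmorphXn rmorphN1.
  have -> : (k`!%:R : K)^-1 = (k`!%:R^-1)%:C by rewrite fmorphV rmorph_nat.
  have -> : (b%:C : K) ^+ k = (b ^+ k)%:C by rewrite rmorphXn.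
  case: (boolP (odd k)) => ok /=.
    have -> : (k.-1./2 = k./2)%N by case: k ok => //= k ok; rewrite uphalf_half (negbTE ok).
    by rewrite expr1; simpc; congr (_ +i* _); ring.
  by rewrite expr0; simpc; congr (_ +i* _); ring.
have vb : series v @ \oo --> (cos b +i* sin b : K).
  apply: cvg_complex.
    have -> : (fun n => complex.Re (series v n)) = series (cos_coeff b).
      by apply/funext => n; rewrite /series /= raddf_sum; apply: eq_bigr => k _ /=; rewrite vE.
    by rewrite cos.unlock; exact: is_cvg_series_cos_coeff.
  have -> : (fun n => complex.Im (series v n)) = series (sin_coeff b).
    by apply/funext => n; rewrite /series /= raddf_sum; apply: eq_bigr => k _ /=; rewrite vE.
  by rewrite sin.unlock; exact: is_cvg_series_sin_coeff.
have zab : (a +i* b : K) = a%:C + 'i%C * b%:C by simpc.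
pose d n := \sum_(k < n.+1) u k * v (n - k)%N.
have dE : d = fun n => (a +i* b : K) ^+ n / n`!%:R.
  by apply/funext => n; rewrite /d exp_binomial -zab.
have /cvg_ex[L dL] : cvg (series d @ \oo).
  have [D h] := exp_coeff_geo (nm_ge0 (a +i* b : K)).
  apply: (geo_cvg (@complex_abs_complete R) (D := D)) => k.
  by rewrite dE nmM nmV nm_nat nmX.
rewrite -dE (_ : cexp _ = L) //; symmetry.
exact: (cauchy_product uD vD ua vb dL).
Qed.

Lemma cexpD (z w : K) : cexp (z + w) = cexp z * cexp w.
Proof.
case: z w => a b [c d]; rewrite /cexp /= expRD cosD sinD; simpc.
by congr (_ +i* _); ring.
Qed.

Lemma cexp0 : cexp (0 : K) = 1.
Proof. by rewrite /cexp /= expR0 cos0 sin0 mul1r. Qed.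

Lemma cexpN (z : K) : cexp (- z) = (cexp z)^-1.
Proof.
have h : cexp z * cexp (- z) = 1 by rewrite -cexpD subrr cexp0.
have z0 : cexp z != 0.
  by apply/eqP => z0; move: h; rewrite z0 mul0r => /eqP; rewrite eq_sym oner_eq0.
by apply: (mulfI z0); rewrite h divff.
Qed.

Lemma cexp_neq0 (z : K) : cexp z != 0.
Proof.
have h : cexp z * cexp (- z) = 1 by rewrite -cexpD subrr cexp0.
by apply/eqP => z0; move: h; rewrite z0 mul0r => /eqP; rewrite eq_sym oner_eq0.
Qed.

Lemma cexpR (a : R) : cexp (a%:C : K) = (expR a)%:C.
Proof. by rewrite /cexp /= cos0 sin0 mulr1. Qed.

Lemma cexp_ln (x : R) : 0 < x -> cexp ((ln x)%:C : K) = x%:C.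
Proof. by move=> x0; rewrite cexpR lnK. Qed.

(** sin(arccos t) = sqrt(1 - t^2) recovers the modulus of the imaginary part, and
    the sign convention of the argument recovers its sign. *)
Lemma clnK (z : K) : z != 0 -> cexp (cln z) = z.
Proof.
move=> z0; have n0 : 0 < Normc.normc z.
  rewrite -nm_normc lt_neqAle nm_ge0 andbT eq_sym; apply: contra z0 => /eqP/nm_eq0->//.
rewrite /cexp /cln /= lnK //.
have reb : -1 <= complex.Re z / Normc.normc z <= 1.
  by rewrite -ler_norml normrM normfV (gtr0_norm n0) ler_pdivrMr // mul1r -nm_normc nm_Re.
have ct : cos (carg z) = complex.Re z / Normc.normc z.
  by rewrite /carg; case: ifP => _; rewrite ?cosN acosK.
have st : sin (carg z) = complex.Im z / Normc.normc z.
  have ss : Num.sqrt (1 - (complex.Re z / Normc.normc z) ^+ 2)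
      = `|complex.Im z| / Normc.normc z.
    rewrite -[RHS]ger0_norm; last by rewrite divr_ge0 // ltW.
    rewrite -[RHS]sqrtr_sqr; congr (Num.sqrt _).
    have nz : Normc.normc z ^+ 2 = complex.Re z ^+ 2 + complex.Im z ^+ 2.
      by case: (z) => a b /=; rewrite sqr_sqrtr // addr_ge0 // sqr_ge0.
    have nn : Normc.normc z != 0 by rewrite gt_eqF.
    rewrite !exprMn !exprVn nz real_normK ?num_real //.
    have nn2 : complex.Re z ^+ 2 + complex.Im z ^+ 2 != 0 by rewrite -nz sqrf_eq0.
    by field.
  rewrite /carg; case: ifPn => h; rewrite ?sinN sin_acos // ss.
    by rewrite ger0_norm.
  by rewrite ler0_norm; [rewrite mulNr opprK | rewrite ltW // ltNge].
rewrite ct st; case: z z0 n0 {reb ct st} => a b z0 n0.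
set N := Normc.normc _ in n0 *.
have nn : N != 0 by rewrite gt_eqF.
by simpc => /=; congr (_ +i* _); field.
Qed.

End ComplexExponential.

(** * Entire power series *)

Section EntireSeries.
Variable R : realType.
Local Notation K := (cplx R).
Implicit Types (a b : K^nat) (r D E : R) (z h : K).

(** The weighted l1 norm of the coefficients is at most D.  Unlike the supremum
    of the sum on a disc, it is controlled by the coefficients alone and is
    submultiplicative for the Cauchy product. *)
Definition wl1 a r D := forall M, \sum_(m < M) nm (a m) * r ^+ m <= D.

Definition entire a := forall r, 0 <= r -> exists D, wl1 a r D.

Definition psum a z : K := lim (series (fun m => a m * z ^+ m) @ \oo).

Definition cprod a b : K^nat := fun n => \sum_(k < n.+1) a k * b (n - k)%N.

Lemma wl1_ge0 a r D : wl1 a r D -> 0 <= D.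
Proof. by move=> /(_ 0%N); rewrite big_ord0. Qed.

Lemma wl1_coef a r D m : 0 <= r -> wl1 a r D -> nm (a m) * r ^+ m <= D.
Proof.
move=> r0 /(_ m.+1); apply: le_trans; rewrite big_ord_recr /= lerDr.
by apply: sumr_ge0 => i _; rewrite mulr_ge0 ?nm_ge0 ?exprn_ge0.
Qed.

Lemma wl1D a b r D E : 0 <= r -> wl1 a r D -> wl1 b r E ->
  wl1 (fun m => a m + b m) r (D + E).
Proof.
move=> r0 aD bE M; apply: le_trans (lerD (aD M) (bE M)).
rewrite -big_split /=; apply: ler_sum => m _.
by rewrite -mulrDl ler_wpM2r ?exprn_ge0 ?nmD.
Qed.

Lemma wl1N a r D : wl1 a r D -> wl1 (fun m => - a m) r D.
Proof. by move=> aD M; under eq_bigr do rewrite nmN; exact: aD. Qed.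

Lemma wl1_cprod a b r D E : 0 <= r -> wl1 a r D -> wl1 b r E ->
  wl1 (cprod a b) r (D * E).
Proof.
move=> r0 aD bE M.
pose c k m := (nm (a k) * r ^+ k) * (nm (b m) * r ^+ m).
have c0 k : 0 <= nm (a k) * r ^+ k by rewrite mulr_ge0 ?nm_ge0 ?exprn_ge0.
apply: le_trans (_ : \sum_(n < M) \sum_(k < n.+1) c k (n - k)%N <= _).
  apply: ler_sum => n _; rewrite /c /cprod.
  apply: le_trans (ler_wpM2r (exprn_ge0 _ r0) (nm_sum _ _ _)) _.
  rewrite mulr_suml; apply: ler_sum => k _.
  by rewrite nmM mulrACA -exprD subnKC // -ltnS.
rewrite triangle_sum.
apply: le_trans (_ : \sum_(k < M) (nm (a k) * r ^+ k) * E <= _).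
  by apply: ler_sum => k _; rewrite -mulr_sumr ler_wpM2l.
by rewrite -mulr_suml ler_wpM2r ?(wl1_ge0 bE).
Qed.

Lemma entire_cprod a b : entire a -> entire b -> entire (cprod a b).
Proof.
move=> ea eb r r0; have [D aD] := ea r r0; have [E bE] := eb r r0.
by exists (D * E); apply: wl1_cprod.
Qed.

Lemma entireD a b : entire a -> entire b -> entire (fun m => a m + b m).
Proof.
move=> ea eb r r0; have [D aD] := ea r r0; have [E bE] := eb r r0.
by exists (D + E); apply: wl1D.
Qed.

Lemma entireN a : entire a -> entire (fun m => - a m).
Proof.
by move=> ea r r0; have [D aD] := ea r r0; exists D; apply: wl1N.
Qed.

(** Geometric decay on the disc of radius r comes from boundedness of the
    coefficients at radius 2r. *)
Lemma entire_geo a r : entire a -> 0 <= r -> exists D, forall m z, nm z <= r ->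
  nm (a m * z ^+ m) <= D * 2^-1 ^+ m.
Proof.
move=> ea r0; have r20 : 0 <= 2 * r by rewrite mulr_ge0.
have [D aD] := ea _ r20; exists D => m z zr.
rewrite nmM nmX exprVn ler_pdivlMr ?exprn_gt0 //.
apply: le_trans (wl1_coef m r20 aD).
rewrite -mulrA ler_wpM2l ?nm_ge0 // -exprMn mulrC.
by rewrite lerXn2r ?nnegrE ?mulr_ge0 ?nm_ge0 // ler_wpM2l.
Qed.

Lemma psum_cvg a z : entire a ->
  series (fun m => a m * z ^+ m) @ \oo --> psum a z.
Proof.
move=> ea; have [D aD] := entire_geo ea (nm_ge0 z).
apply: (geo_cvg (@complex_abs_complete R) (D := D)) => k; exact: aD.
Qed.

Lemma psum_unique a z (l : K) :
  series (fun m => a m * z ^+ m) @ \oo --> l -> psum a z = l.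
Proof. by move=> h; apply: (cvg_lim _ h); exact: norm_hausdorff. Qed.

Lemma psum_cprod a b z : entire a -> entire b ->
  psum (cprod a b) z = psum a z * psum b z.
Proof.
move=> ea eb; have [D aD] := entire_geo ea (nm_ge0 z).
have [E bE] := entire_geo eb (nm_ge0 z).
apply: (cauchy_product (u := fun m => a m * z ^+ m) (v := fun m => b m * z ^+ m)
  (Da := D) (Db := E)).
- by move=> k; exact: aD.
- by move=> k; exact: bE.
- exact: psum_cvg.
- exact: psum_cvg.
rewrite (_ : (fun n => \sum_(k < _) _) = fun m => cprod a b m * z ^+ m).
  exact/psum_cvg/entire_cprod.
apply/funext => n; rewrite /cprod mulr_suml; apply: eq_bigr => k _.
by rewrite mulrACA -exprD subnKC // -ltnS.
Qed.

Lemma psumD a b z : entire a -> entire b ->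
  psum (fun m => a m + b m) z = psum a z + psum b z.
Proof.
move=> ea eb; apply: psum_unique.
rewrite (_ : series _ = fun n => series (fun m => a m * z ^+ m) n +
  series (fun m => b m * z ^+ m) n).
  by apply: cvgD; apply: psum_cvg.
apply/funext => n; rewrite /series /= -big_split; apply: eq_bigr => k _ /=.
by rewrite mulrDl.
Qed.

Lemma psum_le a z D : entire a -> wl1 a (nm z) D -> nm (psum a z) <= D.
Proof.
move=> ea aD; apply: (nm_lim_le (psum_cvg ea)).
near=> n; rewrite /series /= big_mkord; apply: le_trans (nm_sum _ _ _) _.
by apply: le_trans (aD n); apply: ler_sum => m _; rewrite nmM nmX.
Unshelve. all: by end_near. Qed.

(** The coefficients of the derivative of psum a. *)
Definition dcoef a : K^nat := fun m => m.+1%:R * a m.+1.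

Lemma ler_nat_2X m : (m%:R : R) <= 2 ^+ m.
Proof. by rewrite -natrX ler_nat ltnW // ltn_expl. Qed.

Lemma entire_dcoef a : entire a -> entire (dcoef a).
Proof.
move=> ea r r0; have r1 : 0 <= 2 * (r + 1) by lra.
have [D aD] := ea _ r1; exists D => M; apply: le_trans (aD M.+1).
rewrite big_ord_recl /=; apply: ler_wpDl; first by rewrite mulr_ge0 ?nm_ge0.
apply: ler_sum => m _; rewrite /bump /= add1n /dcoef nmM nm_nat.
rewrite [leLHS](_ : _ = nm (a m.+1) * (m.+1%:R * r ^+ m)); last by ring.
rewrite ler_wpM2l ?nm_ge0 // exprMn ler_pM ?exprn_ge0 ?ler_nat_2X //.
apply: le_trans (_ : (r + 1) ^+ m <= _).
  by rewrite lerXn2r ?nnegrE //; lra.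
by rewrite ler_weXn2l //; lra.
Qed.

(** The remainders T_m satisfy T_(m+1) = (z+h) T_m + m h^2 z^(m-1), and the crude
    bound m <= 2^m is enough since the coefficients beat every geometric
    sequence. *)
Lemma taylor_remainder (z h : K) (rho : R) m : 1 <= rho -> nm z <= rho ->
  nm (z + h) <= rho ->
  nm ((z + h) ^+ m - z ^+ m - m%:R * h * z ^+ m.-1) <=
    nm h ^+ 2 * (2 * rho) ^+ m.
Proof.
move=> r1 zr zhr; have r0 : 0 <= rho by lra.
elim: m => [|m IH].
  by rewrite !expr0 subrr !mul0r subr0 nm0 mulr1 exprn_ge0 ?nm_ge0.
have -> : (z + h) ^+ m.+1 - z ^+ m.+1 - m.+1%:R * h * z ^+ m.+1.-1 =
    (z + h) * ((z + h) ^+ m - z ^+ m - m%:R * h * z ^+ m.-1)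
    + m%:R * h ^+ 2 * z ^+ m.-1.
  case: m {IH} => [|m] /=; first by rewrite !expr0 !expr1; ring.
  by rewrite !exprS -[m.+2%:R]natr1; ring.
apply: le_trans (nmD _ _) _; rewrite !nmM nm_nat !nmX.
have p0 : 0 <= (2 * rho) ^+ m by rewrite exprn_ge0 // mulr_ge0.
have h0 : 0 <= nm h ^+ 2 by rewrite exprn_ge0 ?nm_ge0.
have A : nm (z + h) * nm ((z + h) ^+ m - z ^+ m - m%:R * h * z ^+ m.-1) <=
    rho * (nm h ^+ 2 * (2 * rho) ^+ m) by rewrite ler_pM ?nm_ge0.
have B : m%:R * nm z ^+ m.-1 <= rho * (2 * rho) ^+ m.
  apply: le_trans (_ : 1 * (2 * rho) ^+ m <= _); last by rewrite ler_wpM2r.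
  rewrite mul1r exprMn ler_pM ?exprn_ge0 ?nm_ge0 ?ler_nat_2X //.
  apply: le_trans (_ : rho ^+ m.-1 <= _).
    by rewrite lerXn2r ?nnegrE ?nm_ge0.
  by rewrite ler_weXn2l // leq_pred.
have C := ler_wpM2l h0 B; rewrite [(2 * rho) ^+ _]exprS; lra.
Qed.

(** Summing taylor_remainder against the coefficients. *)
Lemma psum_quotient a z : entire a -> exists C, forall h, nm h <= 1 ->
  nm (psum a (z + h) - psum a z - h * psum (dcoef a) z) <= C * nm h ^+ 2.
Proof.
move=> ea; set rho := nm z + 1.
have z0 := nm_ge0 z.
have r1 : 1 <= rho by rewrite /rho; lra.
have r0 : 0 <= 2 * rho by lra.
have [D aD] := ea _ r0; exists D => h h1.
pose T m := a m * ((z + h) ^+ m - z ^+ m - m%:R * h * z ^+ m.-1).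
have TE n : series T n.+1 = series (fun m => a m * (z + h) ^+ m) n.+1 -
    series (fun m => a m * z ^+ m) n.+1 - h * series (fun m => dcoef a m * z ^+ m) n.
  rewrite /series /= !big_mkord -sumrB.
  have -> : h * (\sum_(i < n) dcoef a i * z ^+ i) =
      \sum_(i < n.+1) a i * (i%:R * h * z ^+ i.-1).
    rewrite big_ord_recl /= !mul0r mulr0 add0r mulr_sumr; apply: eq_bigr => i _.
    by rewrite /bump /= add1n /dcoef /=; ring.
  by rewrite -sumrB; apply: eq_bigr => i _; rewrite /T; ring.
have TC : series T n.+1 @[n --> \oo] -->
    psum a (z + h) - psum a z - h * psum (dcoef a) z.
  rewrite (_ : (fun n => _) = fun n => series (fun m => a m * (z + h) ^+ m) n.+1 -
    series (fun m => a m * z ^+ m) n.+1 - h * series (fun m => dcoef a m * z ^+ m) n);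
    last exact/funext.
  apply: cvgB; last by apply: cvg_mulcl; exact/psum_cvg/entire_dcoef.
  have s1 := psum_cvg (z := z + h) ea; have s2 := psum_cvg (z := z) ea.
  by apply: cvgB; rewrite cvg_shiftS; [exact: s1|exact: s2].
apply: (nm_lim_le TC); near=> n.
rewrite /series /= big_mkord; apply: le_trans (nm_sum _ _ _) _.
apply: le_trans (_ : \sum_(m < n.+1) (nm (a m) * (2 * rho) ^+ m) * nm h ^+ 2 <= _).
  apply: ler_sum => m _; rewrite /T nmM -[leRHS]mulrA ler_wpM2l ?nm_ge0 // [leRHS]mulrC.
  apply: taylor_remainder => //; first by rewrite /rho; lra.
  by apply: le_trans (nmD _ _) _; rewrite /rho; lra.
by rewrite -mulr_suml ler_wpM2r ?exprn_ge0 ?nm_ge0.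
Unshelve. all: by end_near. Qed.

Lemma psum_is_derive a z : entire a ->
  is_derive (z : K) (1 : K) (psum a) (psum (dcoef a) z).
Proof.
move=> ea; have [C hC] := psum_quotient z ea.
have lim : h^-1 *: ((psum a \o shift z) (h *: (1 : K)) - psum a z)
    @[h --> (0 : K)^'] --> psum (dcoef a) z.
  apply/cvgrPdist_lt => e0; case: e0 => e e'; rewrite ltcE /= => /andP[/eqP-> e0].
  (* psum_quotient needs |h| <= 1; |C| + 1 avoids dividing by zero *)
pose d := Num.min 1 (e / (`|C| + 1)).
  have C0 := normr_ge0 C.
  have d0 : 0 < d by rewrite lt_min ltr01 divr_gt0 //; lra.
  have near0 : \forall h \near ((0 : K)^'), (h : K) != 0 /\ nm (h : K) < d.
    have n1 : \forall h \near ((0 : K)^'), (h : K) != 0 by exact: withinT.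
    have n2 : \forall h \near ((0 : K)^'), `|h : K| < (d%:C : K).
      by apply: dnbhs0_lt; rewrite ltcR.
    by apply: filterS2 n1 n2 => h h0; rewrite nmE ltcR.
  apply: filterS near0 => h [h0 hd]; rewrite nmE ltcR.
  have [h1 he] : nm h < 1 /\ nm h < e / (`|C| + 1).
    by move: hd; rewrite lt_min => /andP[].
  have nh0 : 0 < nm h.
    by rewrite lt_neqAle nm_ge0 andbT eq_sym; apply: contra h0 => /eqP/nm_eq0->.
  have := hC h (ltW h1).
  have -> : psum a (z + h) - psum a z - h * psum (dcoef a) z =
    - h * (psum (dcoef a) z - h^-1 *: ((psum a \o shift z) (h *: (1 : K)) - psum a z)).
    rewrite /= /shift /= scaler1 [h + z]addrC -[_ *: _]/(h^-1 * (psum a (z + h) - psum a z)).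
    by rewrite mulrBr !mulNr mulrA divff // mul1r opprK addrC.
  rewrite nmM nmN expr2 mulrCA ler_pM2l // => H; apply: (le_lt_trans H).
  move: he; rewrite ltr_pdivlMr; last by lra.
  have := ler_norm C; nra.
by split; [apply/cvg_ex; exists (psum (dcoef a) z)|apply: cvg_lim].
Qed.

Lemma psum_derive1n a j : entire a ->
  derive1n j (psum a) = psum (iter j dcoef a) /\ entire (iter j dcoef a).
Proof.
move=> ea; elim: j => [|j [IH1 IH2]] //.
split; last exact: entire_dcoef.
rewrite derive1nS IH1; apply/funext => z; rewrite derive1E.
by have [_ <-] := psum_is_derive z IH2.
Qed.

Lemma psum_derivable a j z : entire a -> derivable (derive1n j (psum a)) z 1.
Proof.
move=> ea; have [-> ej] := psum_derive1n j ea.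
by have [] := psum_is_derive z ej.
Qed.

End EntireSeries.

(** * The reciprocal gamma function is entire *)

Section ReciprocalGamma.
Variable R : realType.
Local Notation K := (cplx R).
Implicit Types (a b : K^nat) (r : R) (z : K).

(** The approximants of the Euler-Gauss limit. *)
Definition gauss n z : K :=
  (\prod_(j < n.+1) (z + j%:R)) / (n`!%:R * cexp (z * (ln n%:R)%:C)).

Definition lnstep n : R := ln n.+2%:R - ln n.+1%:R.

Lemma lnstep_bounds n : n.+2%:R^-1 <= lnstep n <= n.+1%:R^-1.
Proof.
have a0 : 0 < (n.+1%:R : R) by rewrite ltr0n.
have b0 : 0 < (n.+2%:R : R) by rewrite ltr0n.
have ab : (n.+2%:R : R) = n.+1%:R + 1 by rewrite -natr1.
rewrite /lnstep; apply/andP; split.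
  rewrite -lerN2 opprB -ln_div ?posrE //.
  have F (y : R) : 0 < y -> y / (y + 1) = 1 + - (y + 1)^-1.
    by move=> y0; field; rewrite gt_eqF //; lra.
  rewrite ab (F _ a0) -ab.
  by apply: le_ln1Dx; rewrite ltrN2 invf_lt1 // ltr1n.
rewrite -ln_div ?posrE //.
have -> : n.+2%:R / n.+1%:R = 1 + n.+1%:R^-1 :> R.
  by rewrite ab mulrDl divff ?gt_eqF // mul1r.
by apply: le_ln1Dx; apply: lt_trans (_ : 0 < _); rewrite ?ltrN10 ?invr_gt0.
Qed.

(** The coefficients of 1 + z / (n+2). *)
Definition lin_coef n : K^nat := fun m =>
  if m is m'.+1 then (if m' is 0%N then n.+2%:R^-1 else 0) else 1.

(** The coefficients of exp(- lnstep n * z). *)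
Definition exp_coef n : K^nat := fun m => ((- lnstep n)%:C) ^+ m / m`!%:R.

(** The coefficients of the quotient gauss (n+2) / gauss (n+1). *)
Definition factor_coef n : K^nat := cprod (lin_coef n) (exp_coef n).

Lemma entire_lin_coef n : entire (lin_coef n).
Proof.
move=> r r0; exists (1 + r) => M.
apply: le_trans (_ : \sum_(m < M.+2) nm (lin_coef n m) * r ^+ m <= _).
  rewrite -addn2 big_split_ord /= lerDl; apply: sumr_ge0 => i _.
  by rewrite mulr_ge0 ?nm_ge0 ?exprn_ge0.
rewrite !big_ord_recl big1 => [|i _]; last by rewrite /= nm0 mul0r.
rewrite /= expr0 expr1 nm1 mulr1 addr0 lerD2l ler_piMl // nmV nm_nat.
by rewrite invf_le1 ?ltr0n // ler1n.
Qed.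

Lemma psum_lin_coef n z : psum (lin_coef n) z = 1 + z / n.+2%:R.
Proof.
apply: psum_unique; apply: (nm_squeeze (e := fun=> 0)); last exact: cvg_cst.
near=> m; have m2 : (2 <= m)%N by near: m; exact: nbhs_infty_ge.
rewrite /series /= -(subnK m2) addn2 big_mkord !big_ord_recl.
rewrite big1 => [|i _]; last by rewrite /= mul0r.
rewrite /= expr0 expr1 mulr1 addr0 [n.+2%:R^-1 * z]mulrC subrr nm0 lexx //.
Unshelve. all: by end_near. Qed.

Lemma entire_exp_coef n : entire (exp_coef n).
Proof.
move=> r r0; exists (expR (`|lnstep n| * r)) => M.
apply: le_trans (exp_sum_le M _); last by rewrite mulr_ge0.
apply: ler_sum => m _; rewrite /exp_coef nmM nmV nm_nat nmX nmC normrN.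
by rewrite exprMn mulrAC.
Qed.

Lemma psum_exp_coef n z : psum (exp_coef n) z = cexp (- (lnstep n)%:C * z).
Proof.
apply: psum_unique.
rewrite (_ : (fun m => _) = fun m => (- (lnstep n)%:C * z) ^+ m / m`!%:R).
  exact: cexp_series.
by apply/funext => m; rewrite /exp_coef exprMn rmorphN /= mulrAC.
Qed.

Lemma entire_factor_coef n : entire (factor_coef n).
Proof. by apply: entire_cprod; [exact: entire_lin_coef|exact: entire_exp_coef]. Qed.

Lemma psum_factor_coef n z :
  psum (factor_coef n) z = (1 + z / n.+2%:R) * cexp (- (lnstep n)%:C * z).
Proof.
by rewrite psum_cprod ?psum_lin_coef ?psum_exp_coef //;
  [exact: entire_lin_coef|exact: entire_exp_coef].
Qed.

Lemma gauss_step n z : gauss n.+2 z = gauss n.+1 z * psum (factor_coef n) z.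
Proof.
rewrite psum_factor_coef /gauss big_ord_recr /=.
have -> : z * (ln n.+2%:R)%:C = z * (ln n.+1%:R)%:C + (lnstep n)%:C * z.
  by rewrite [_ * z]mulrC -mulrDr /lnstep rmorphB /= subrKC.
rewrite cexpD mulNr cexpN factS natrM.
have e1 := cexp_neq0 (z * (ln n.+1%:R)%:C).
have e2 := cexp_neq0 ((lnstep n)%:C * z).
have f0 : (n.+1`!%:R : K) != 0 by rewrite pnatr_eq0 -lt0n fact_gt0.
have n0 : (n.+2%:R : K) != 0 by rewrite pnatr_eq0.
have -> : 1 + z / n.+2%:R = (z + n.+2%:R) / n.+2%:R by rewrite mulrDl divff // addrC.
rewrite !invfM; ring.
Qed.

Local Notation hrm := (@harmonic R).

Lemma harmonic0 : hrm 0%N = (1 : R).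
Proof. by rewrite /harmonic /= invr1. Qed.

Lemma harmonic_le1 n : hrm n <= 1.
Proof. by rewrite invf_le1 ?ltr0n // ler1n. Qed.

(** 1/(n+1)^2 is dominated by a telescoping difference, so that sums of
    1/(n+1)^2 are bounded without a closed form. *)
Lemma harmonic_sqr_le n : hrm n ^+ 2 <= 2 * (hrm n - hrm n.+1).
Proof.
have F (y : R) : 1 <= y -> y^-1 ^+ 2 <= 2 * (y^-1 - (y + 1)^-1).
  move=> y1; have y0 : 0 < y by lra.
  have yy : 0 < y + 1 by lra.
  have -> : y^-1 - (y + 1)^-1 = y^-1 * (y + 1)^-1 by field; rewrite !gt_eqF.
  rewrite expr2 mulrCA; apply: ler_wpM2l; first by rewrite invr_ge0 ltW.
  have -> : 2 / (y + 1) = ((y + 1) / 2)^-1 by rewrite invfM invrK mulrC.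
  by rewrite lef_pV2 ?posrE //; lra.
by rewrite /harmonic /= -[n.+2%:R]natr1; apply: F; rewrite ler1n.
Qed.

(** The coefficients of gauss (n+2) / gauss (n+1) - 1. *)
Definition factor1_coef n : K^nat := fun m => factor_coef n m - (m == 0)%:R.

Lemma factor_coefS n m : factor_coef n m.+1 = exp_coef n m.+1 + n.+2%:R^-1 * exp_coef n m.
Proof.
rewrite /factor_coef /cprod !big_ord_recl big1 => [|i _]; last by rewrite /= mul0r.
by rewrite /= subn0 mul1r subSS subn0 addr0.
Qed.

Definition rbound r : R := (1 + r) * expR r.

Lemma rbound_ge0 r : 0 <= r -> 0 <= rbound r.
Proof. by move=> r0; rewrite mulr_ge0 ?expR_ge0 ?addr_ge0. Qed.

(** The first-order coefficient of (1 + z/(n+2)) exp(- d z) is 1/(n+2) - d, where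
    1/(n+2) <= d <= 1/(n+1), hence of order 1/n^2; the later ones contain d^2 or
    d/(n+2).  This cancellation is what makes the Euler-Gauss product converge. *)
Lemma wl1_factor1 n r : 0 <= r ->
  wl1 (factor1_coef n) r (rbound r * hrm n ^+ 2).
Proof.
move=> r0; set e : R := hrm n; set t : R := n.+2%:R^-1; set d := lnstep n.
have e0 : 0 <= e by exact: (@harmonic_ge0 R).
have t0 : 0 <= t by rewrite invr_ge0.
have e1 : e <= 1 by exact: harmonic_le1.
have /andP[td de] := lnstep_bounds n.
have te : t <= e by apply: le_trans td de.
have dt : d - t <= e ^+ 2.
  apply: le_trans (_ : e - t <= _); first by rewrite lerD2r.
  have -> : e - t = e * t.
    have F (y : R) : 0 < y -> y^-1 - (y + 1)^-1 = y^-1 * (y + 1)^-1.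
      by move=> y0; field; rewrite !gt_eqF //; lra.
    by rewrite /e /harmonic /= /t -[n.+2%:R]natr1 F // ltr0n.
  by rewrite expr2 ler_wpM2l.
have d0 : 0 <= d by apply: le_trans td.
pose p m := r ^+ m / m`!%:R.
have p0 m : 0 <= p m by rewrite divr_ge0 ?exprn_ge0.
pose w m := if m is m'.+1 then r * p m' else 0.
have w0 m : 0 <= w m by case: m => //= m; rewrite mulr_ge0.
have nec m : nm (exp_coef n m) * r ^+ m = d ^+ m * p m.
  rewrite /exp_coef nmM nmV nm_nat nmX nmC normrN ger0_norm // /p -mulrA; congr (_ * _).
  exact: mulrC.
(* p bounds the contribution of exp(- d z), w that of z/(n+2) exp(- d z) *)
have key m : nm (factor1_coef n m) * r ^+ m <= e ^+ 2 * (p m + w m).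
  have epw k : 0 <= e ^+ 2 * (p k + w k) by rewrite mulr_ge0 ?exprn_ge0 ?addr_ge0.
  case: m => [|m].
    rewrite /factor1_coef /factor_coef /cprod big_ord1 /= /exp_coef fact0 invr1 expr0 !mulr1 subrr.
    by rewrite nm0; exact: (epw 0%N).
  rewrite /factor1_coef /= subr0 factor_coefS; case: m => [|m].
    rewrite /exp_coef expr1 expr0 fact0 invr1 !mulr1.
    have -> : (- d)%:C + n.+2%:R^-1 = (- (d - t))%:C :> K.
      have tK : (t%:C : K) = n.+2%:R^-1 by rewrite /t fmorphV rmorph_nat.
      have -> : - (d - t) = - d + t by rewrite opprB addrC.
      by rewrite -tK; simpc.
    rewrite nmC normrN ger0_norm ?subr_ge0 // expr1 /w /p /= fact0 expr0 invr1 !mulr1.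
    by rewrite ler_pM ?subr_ge0 // lerDr.
  apply: le_trans (ler_wpM2r (exprn_ge0 _ r0) (nmD _ _)) _.
  rewrite mulrDl nec nmM nmV nm_nat -/t [r ^+ m.+2]exprS.
  rewrite [X in _ + X](_ : _ = t * d ^+ m.+1 * (r * p m.+1)); last first.
    by rewrite -[RHS]mulrA [_ * (r * _)]mulrCA -nec; ring.
  rewrite mulrDr; apply: lerD.
    apply: ler_wpM2r => //.
    apply: le_trans (_ : e ^+ m.+2 <= _); first by rewrite lerXn2r ?nnegrE.
    by rewrite -addn2 exprD ler_piMl ?exprn_ge0 // exprn_ile1.
  apply: ler_wpM2r; first by rewrite mulr_ge0.
  rewrite expr2; apply: ler_pM => //; first by rewrite exprn_ge0.
  apply: le_trans (_ : e ^+ m.+1 <= _); first by rewrite lerXn2r ?nnegrE.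
  by rewrite exprS ler_piMr // exprn_ile1.
move=> M; apply: le_trans (_ : \sum_(m < M) e ^+ 2 * (p m + w m) <= _).
  by apply: ler_sum.
rewrite -mulr_sumr mulrC ler_wpM2r ?exprn_ge0 // big_split /= /rbound mulrDl mul1r.
apply: lerD; first exact: exp_sum_le.
case: M => [|M]; first by rewrite big_ord0 mulr_ge0 ?expR_ge0.
by rewrite big_ord_recl /= add0r -mulr_sumr ler_wpM2l // exp_sum_le.
Qed.

Lemma cprod_factor a n : cprod a (factor_coef n) = fun m => a m + cprod a (factor1_coef n) m.
Proof.
apply/funext => m; rewrite /cprod /factor1_coef !big_ord_recr /= subnn eqxx.
rewrite (eq_bigr (fun k : 'I_m =>
  a k * (factor_coef n (m - k)%N - ((m - k)%N == 0)%:R))); last first.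
  by move=> k _; rewrite subn_eq0 leqNgt ltn_ord subr0.
by rewrite mulrBr mulr1 addrCA [_ + (_ - _)]addrC subrK.
Qed.

(** The coefficients of gauss (n+1), built from gauss 1 z = z + z^2. *)
Fixpoint gauss_coef n : K^nat :=
  if n is n'.+1 then cprod (gauss_coef n') (factor_coef n')
  else fun m => ((m == 1) || (m == 2))%:R.

Lemma wl1_gauss_coef0 r : 0 <= r -> wl1 (gauss_coef 0) r (r + r ^+ 2).
Proof.
move=> r0 M.
apply: le_trans (_ : \sum_(m < M.+3) nm (gauss_coef 0 m) * r ^+ m <= _).
  rewrite -addn3 big_split_ord /= lerDl; apply: sumr_ge0 => i _.
  by rewrite mulr_ge0 ?nm_ge0 ?exprn_ge0.
rewrite !big_ord_recl big1 => [|i _]; last by rewrite /= nm0 mul0r.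
by rewrite /= nm0 mul0r nm1 !mul1r expr1 add0r addr0.
Qed.

Lemma entire_gauss_coef n : entire (gauss_coef n).
Proof.
elim: n => [|n IH] /=; last by apply: entire_cprod => //; exact: entire_factor_coef.
by move=> r r0; exists (r + r ^+ 2); exact: wl1_gauss_coef0.
Qed.

Lemma gaussE n z : gauss n.+1 z = psum (gauss_coef n) z.
Proof.
elim: n => [|n IH]; last first.
  rewrite gauss_step IH /= psum_cprod //; first exact: entire_gauss_coef.
  exact: entire_factor_coef.
rewrite /gauss !big_ord_recl big_ord0 /= ln1 mulr0 cexp0; rewrite !mulr1 addr0 divr1.
apply/esym/psum_unique.
apply: (nm_squeeze (e := fun=> 0)); last exact: cvg_cst.
near=> m; have m2 : (3 <= m)%N by near: m; exact: nbhs_infty_ge.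
rewrite /series /= -(subnK m2) addn3 big_mkord !big_ord_recl.
rewrite big1 => [|i _]; last by rewrite /= mul0r.
rewrite /= mul0r !mul1r add0r addr0 expr1 /bump /= -[X in nm X](_ : 0 = _) ?nm0 //.
by rewrite expr2; ring.
Unshelve. all: by end_near. Qed.

(** A bound, independent of n, of the weighted l1 norm of gauss (n+1): the norm of
    z + z^2 times the exponential of the total of the increments. *)
Definition gbound r : R := (r + r ^+ 2) * expR (2 * rbound r).

Lemma gbound_ge0 r : 0 <= r -> 0 <= gbound r.
Proof. by move=> r0; rewrite mulr_ge0 ?expR_ge0 ?addr_ge0 ?exprn_ge0. Qed.

(** The bound grows by the factor 1 + C/(n+1)^2 <= exp(2C (1/(n+1) - 1/(n+2))),
    and the exponents telescope to at most 2C. *)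
Lemma wl1_gauss_coef n r : 0 <= r -> wl1 (gauss_coef n) r (gbound r).
Proof.
move=> r0; have C0 := rbound_ge0 r0; set C := rbound r in C0 *.
have B0 : 0 <= r + r ^+ 2 by rewrite addr_ge0 ?exprn_ge0.
suff H : wl1 (gauss_coef n) r ((r + r ^+ 2) * expR (2 * C * (1 - hrm n))).
  move=> M; apply: le_trans (H M) _; rewrite ler_wpM2l // ler_expR.
  have := (@harmonic_ge0 R) n => t0.
  by have := mulr_ge0 C0 t0; rewrite -/C; lra.
elim: n => [|n IH].
  by rewrite harmonic0 subrr mulr0 expR0 mulr1; exact: wl1_gauss_coef0.
rewrite /= cprod_factor => M.
apply: le_trans (wl1D r0 IH (wl1_cprod r0 IH (wl1_factor1 n r0)) M) _.
rewrite -/C -[X in X + _]mulr1 -mulrDr -mulrA ler_wpM2l //.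
have -> : 2 * C * (1 - hrm n.+1) =
    2 * C * (1 - hrm n) + C * (2 * (hrm n - hrm n.+1)) by ring.
rewrite expRD ler_wpM2l ?expR_ge0 //.
apply: le_trans (expR_ge1Dx _); rewrite lerD2l ler_wpM2l //.
exact: harmonic_sqr_le.
Qed.

Lemma wl1_gauss_coef_diff n k r : 0 <= r ->
  wl1 (fun m => gauss_coef (n + k) m - gauss_coef n m) r
    (2 * gbound r * rbound r * (hrm n - hrm (n + k)%N)).
Proof.
move=> r0; have C0 := rbound_ge0 r0; have B0 := gbound_ge0 r0.
elim: k => [|k IH].
  rewrite addn0 subrr mulr0 => M; rewrite big1 // => i _.
  by rewrite subrr nm0 mul0r.
rewrite addnS [gauss_coef (n + k).+1]/= cprod_factor => M.
have H := wl1D r0 IH (wl1_cprod r0 (wl1_gauss_coef (n + k) r0) (wl1_factor1 (n + k) r0)).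
rewrite (eq_bigr (fun m : 'I_M => nm (gauss_coef (n + k) m - gauss_coef n m +
  cprod (gauss_coef (n + k)) (factor1_coef (n + k)) m) * r ^+ m)); last first.
  by move=> i _; rewrite addrAC.
apply: le_trans (H M) _.
have T := ler_wpM2l (mulr_ge0 B0 C0) (harmonic_sqr_le (n + k)%N).
by lra.
Qed.

Lemma gauss_coef_cvg m : cvg (gauss_coef n m @[n --> \oo]).
Proof.
pose u k := gauss_coef k.+1 m - gauss_coef k m.
have uE : (fun n => gauss_coef n m) = fun n => gauss_coef 0 m + series u n.
  by apply/funext => n; rewrite /series /= telescope_sumr // subrKC.
have /cvg_ex[l ul] : cvg (series u @ \oo).
  apply: (@complex_abs_complete R _ (2 * gbound 1 * rbound 1)) => n.
  have C0 := rbound_ge0 (@ler01 R); have B0 := gbound_ge0 (@ler01 R).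
  apply: le_trans (_ : \sum_(k < n) 2 * gbound 1 * rbound 1 * (hrm k - hrm k.+1) <= _).
    apply: ler_sum => k _.
    have := wl1_coef m (@ler01 R) (wl1_gauss_coef_diff k 1 (@ler01 R)).
    by rewrite expr1n mulr1 addn1.
  rewrite -mulr_sumr -(big_mkord xpredT (fun k => hrm k - hrm k.+1)).
  rewrite (eq_bigr (fun k => - hrm k.+1 - (- hrm k))) => [|k _]; last by rewrite opprK addrC.
  rewrite telescope_sumr // ler_piMr ?mulr_ge0 //.
  by have := (@harmonic_ge0 R) n; rewrite harmonic0; lra.
rewrite uE; apply/cvg_ex; exists (gauss_coef 0 m + l).
by apply: cvgD; [exact: cvg_cst|exact: ul].
Qed.

Definition rGamma_coef : K^nat := fun m => lim (gauss_coef n m @[n --> \oo]).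

(** The estimate of wl1_gauss_coef_diff passes to the limit in each finite
    partial sum. *)
Lemma wl1_rGamma_coef n r : 0 <= r ->
  wl1 (fun m => rGamma_coef m - gauss_coef n m) r (2 * gbound r * rbound r * hrm n).
Proof.
move=> r0 M; have C0 := rbound_ge0 r0; have B0 := gbound_ge0 r0.
pose s k := \sum_(m < M) nm (gauss_coef k m - gauss_coef n m) * r ^+ m.
have sc : s @ \oo --> \sum_(m < M) nm (rGamma_coef m - gauss_coef n m) * r ^+ m.
  rewrite /s; elim: M {s} => [|M IH].
    rewrite big_ord0 (_ : (fun=> _) = fun=> 0); first exact: cvg_cst.
    by apply/funext => k; rewrite big_ord0.
  rewrite big_ord_recr /= (_ : (fun=> _) = fun k =>
    \sum_(m < M) nm (gauss_coef k m - gauss_coef n m) * r ^+ m +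
    nm (gauss_coef k M - gauss_coef n M) * r ^+ M); last first.
    by apply/funext => k; rewrite big_ord_recr.
  apply: cvgD; first exact: IH.
  apply: cvgMr_tmp; apply: cvg_nm.
  by apply: cvgB; [exact: gauss_coef_cvg|exact: cvg_cst].
rewrite -(cvg_lim _ sc) //; apply: limr_le.
  by apply/cvg_ex; eexists; exact: sc.
near=> k; have nk : (n <= k)%N by near: k; exact: nbhs_infty_ge.
rewrite /s -(subnKC nk); apply: le_trans (wl1_gauss_coef_diff n (k - n) r0 M) _.
apply: ler_wpM2l; first by rewrite mulr_ge0 // mulr_ge0.
by rewrite gerBl (@harmonic_ge0 R).
Unshelve. all: by end_near. Qed.

Lemma entire_rGamma_coef : entire rGamma_coef.
Proof.
have -> : rGamma_coef = fun m => gauss_coef 0 m + (rGamma_coef m - gauss_coef 0 m).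
  by apply/funext => m; rewrite subrKC.
apply: entireD; first exact: entire_gauss_coef.
by move=> r r0; eexists; exact: wl1_rGamma_coef.
Qed.

Lemma gauss_cvg_psum z : gauss n z @[n --> \oo] --> psum rGamma_coef z.
Proof.
suff H : (fun n => gauss n.+1 z) @ \oo --> psum rGamma_coef z.
  by rewrite (cvg_shiftS (fun n => gauss n z)) in H; exact: H.
pose e n : R := 2 * gbound (nm z) * rbound (nm z) * hrm n.
apply: (nm_squeeze (e := e)); last first.
  have h c : (fun n => c * hrm n) @ \oo --> (c * 0 : R).
    by apply: cvgMl_tmp; exact: cvg_harmonic.
  by have := h (2 * gbound (nm z) * rbound (nm z)); rewrite mulr0.
near=> n; rewrite gaussE.
have -> : psum rGamma_coef z - psum (gauss_coef n) z =
    psum (fun m => rGamma_coef m - gauss_coef n m) z.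
  rewrite psumD; [|exact: entire_rGamma_coef|exact/entireN/entire_gauss_coef].
  congr (_ + _); apply/esym/psum_unique.
  rewrite (_ : series _ = fun k => - series (fun m => gauss_coef n m * z ^+ m) k).
    apply: cvgN; exact/psum_cvg/entire_gauss_coef.
  by apply/funext => k; rewrite /series /= -sumrN; apply: eq_bigr => i _; rewrite mulNr.
apply: psum_le; last exact/wl1_rGamma_coef/nm_ge0.
by apply: entireD; [exact: entire_rGamma_coef|exact/entireN/entire_gauss_coef].
Unshelve. all: by end_near. Qed.

Lemma crGammaE : @crGamma R = psum rGamma_coef.
Proof.
apply/funext => z; apply: cvg_lim; first exact: norm_hausdorff.
exact: gauss_cvg_psum.
Qed.

Lemma gauss_cvg z : gauss n z @[n --> \oo] --> crGamma z.
Proof. by rewrite crGammaE; exact: gauss_cvg_psum. Qed.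

Lemma crGamma_smooth j z : derivable (derive1n j (@crGamma R)) z 1.
Proof. by rewrite crGammaE; exact/psum_derivable/entire_rGamma_coef. Qed.

(** Both sides contain the product of z, z+1, ..., z+n+2. *)
Lemma gauss_shift n z :
  z * gauss n.+1 (z + 1) = gauss n.+1 z + gauss n.+1 z * (z + 1) / n.+1%:R.
Proof.
have n0 : (n.+1%:R : K) != 0 by rewrite pnatr_eq0.
have -> : gauss n.+1 z + gauss n.+1 z * (z + 1) / n.+1%:R =
  gauss n.+1 z * (z + n.+2%:R) / n.+1%:R.
  by rewrite -[n.+2%:R]natr1; set y := n.+1%:R in n0 *; clearbody y; field.
rewrite /gauss mulrDl mul1r cexpD cexp_ln ?ltr0n // rmorph_nat.
have P : (\prod_(j < n.+2) (z + j%:R)) * (z + n.+2%:R) =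
    z * \prod_(j < n.+2) (z + 1 + j%:R).
  have <- : \prod_(j < n.+3) (z + j%:R) = (\prod_(j < n.+2) (z + j%:R)) * (z + n.+2%:R).
    by rewrite big_ord_recr.
  rewrite big_ord_recl /= addr0; congr (_ * _); apply: eq_bigr => j _.
  by rewrite /bump /= add1n -natr1 -addrA [1 + _]addrC.
rewrite mulrA -P !invfM; ring.
Qed.

Lemma crGamma_shift z : crGamma z = z * crGamma (z + 1).
Proof.
have h1 : z * gauss n.+1 (z + 1) @[n --> \oo] --> z * crGamma (z + 1).
  apply: cvg_mulcl; rewrite (cvg_shiftS (fun n => gauss n (z + 1))).
  exact: gauss_cvg.
have h2 : z * gauss n.+1 (z + 1) @[n --> \oo] --> crGamma z.
  have g : gauss n.+1 z @[n --> \oo] --> crGamma z.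
    by rewrite (cvg_shiftS (fun n => gauss n z)); exact: gauss_cvg.
  rewrite (_ : (fun n => _) = fun n => gauss n.+1 z + gauss n.+1 z * (z + 1) / n.+1%:R); last first.
    by apply/funext => n; exact: gauss_shift.
  rewrite [X in _ --> X](_ : _ = crGamma z + crGamma z * (z + 1) * 0); last first.
    by rewrite mulr0 addr0.
  apply: cvgD; first exact: g.
  apply: cvgM; first by apply: cvg_mulcr; exact: g.
  apply: (nm_squeeze (e := hrm)); last exact: cvg_harmonic.
  by near=> n; rewrite sub0r nmN nmV nm_nat /harmonic /= lexx.
by apply: (cvg_unique _ h2 h1); exact: norm_hausdorff.
Unshelve. all: by end_near. Qed.

(** The l1 estimate at radius |z| is a pointwise estimate at z. *)
Lemma factor_near1 n z : nm (psum (factor_coef n) z - 1) <= rbound (nm z) * hrm n ^+ 2.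
Proof.
have ue : entire (factor1_coef n) by move=> r r0; eexists; exact: wl1_factor1.
have -> : psum (factor_coef n) z - 1 = psum (factor1_coef n) z.
  pose o : K^nat := fun m => (m == 0)%:R.
  have oe : entire o.
    move=> r r0; exists 1 => M; case: M => [|M]; first by rewrite big_ord0.
    rewrite big_ord_recl big1 => [|i _]; last by rewrite /o /= nm0 mul0r.
    by rewrite /o /= nm1 mul1r expr0 addr0.
  have -> : factor_coef n = fun m => factor1_coef n m + o m.
    by apply/funext => m; rewrite /factor1_coef subrK.
  rewrite psumD // (_ : psum o z = 1) ?addrK //.
  apply: psum_unique; apply: (nm_squeeze (e := fun=> 0)); last exact: cvg_cst.
  near=> m; have m1 : (0 < m)%N by near: m; exact: nbhs_infty_ge.
  rewrite /series /= -(prednK m1) big_mkord big_ord_recl.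
  rewrite big1 => [|i _]; last by rewrite /o /= mul0r.
  by rewrite /o /= mul1r expr0 addr0 subrr nm0 lexx.
by apply: psum_le => //; exact/wl1_factor1/nm_ge0.
Unshelve. all: by end_near. Qed.

(** From some index q on, the factors 1 + u_n satisfy sum |u_n| <= 1/2, and then
    prod |1 + u_n| >= 1 - sum |u_n| >= 1/2; so the modulus of the limit is at least
    half that of gauss (q+1), a product of nonzero numbers. *)
Lemma crGamma_neq0 z : (forall j : nat, z + j%:R != 0) -> crGamma z != 0.
Proof.
move=> zj; have C0 := rbound_ge0 (nm_ge0 z); set C := rbound (nm z) in C0.
have [q Cq] : exists q, 2 * C * hrm q <= 2^-1.
  move/cvgrPdist_lt: (@cvg_harmonic R) => h.
  have e0 : 0 < (4 * (C + 1))^-1 by rewrite invr_gt0; lra.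
  have [q _ hq] := h _ e0; exists q.
  have := hq q (leqnn q); rewrite sub0r normrN ger0_norm ?(@harmonic_ge0 R) //= => tq.
  have : 2 * C * hrm q <= 2 * C * (4 * (C + 1))^-1.
    by apply: ler_wpM2l; [rewrite mulr_ge0|exact: ltW].
  move=> /le_trans; apply; rewrite ler_pdivrMr; lra.
have g0 : 0 < nm (gauss q.+1 z).
  rewrite lt_neqAle nm_ge0 andbT eq_sym; apply/eqP => /nm_eq0/eqP.
  rewrite /gauss mulf_eq0 invr_eq0 mulf_eq0 (negbTE (cexp_neq0 _)) orbF.
  have -> : (q.+1`!%:R == 0 :> K) = false by rewrite pnatr_eq0 gtn_eqF ?fact_gt0.
  rewrite orbF.
  by apply/negP/prodf_neq0 => i _; exact: zj.
have low k : nm (gauss q.+1 z) * (1 - 2 * C * (hrm q - hrm (q + k)%N)) <=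
    nm (gauss (q + k).+1 z).
  elim: k => [|k IH]; first by rewrite addn0 subrr mulr0 subr0 mulr1.
  rewrite addnS gauss_step nmM.
  have f1 := factor_near1 (q + k) z; rewrite -/C in f1.
  have f2 : 1 - C * hrm (q + k)%N ^+ 2 <= nm (psum (factor_coef (q + k)) z).
    have := nmD (1 - psum (factor_coef (q + k)) z) (psum (factor_coef (q + k)) z).
    by rewrite subrK nm1 nm_distC; lra.
  have t2 := harmonic_sqr_le (q + k)%N.
  have Ct := ler_wpM2l C0 t2.
  have t0 := (@harmonic_ge0 R) (q + k)%N.
  have t1 := (@harmonic_ge0 R) (q + k)%N.+1.
  have s0 : 0 <= C * hrm (q + k)%N ^+ 2 by rewrite mulr_ge0 ?exprn_ge0.
  have tm : hrm (q + k)%N <= hrm q.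
    by rewrite /harmonic /= lef_pV2 ?posrE ?ltr0n // ler_nat ltnS leq_addr.
  set s := C * hrm (q + k)%N ^+ 2 in f1 f2 s0 Ct *.
  set w := 2 * C * (hrm q - hrm (q + k)%N) in IH *.
  have w0 : 0 <= w by apply: mulr_ge0; [exact: mulr_ge0|rewrite subr_ge0].
  have w1 : w <= 2^-1.
    have := mulr_ge0 C0 t0; rewrite /w; lra.
  have s1 : s <= 2^-1.
    have := mulr_ge0 C0 t1; have := ler_wpM2l C0 tm; lra.
  apply: le_trans (_ : nm (gauss q.+1 z) * (1 - w) * (1 - s) <= _); last first.
    rewrite ler_pM //; first by rewrite mulr_ge0 ?nm_ge0 //; lra.
    lra.
  rewrite -[leRHS]mulrA; apply: ler_wpM2l; first exact: nm_ge0.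
  have ws := mulr_ge0 w0 s0.
  have -> : 2 * C * (hrm q - hrm (q + k)%N.+1) =
    w + 2 * C * (hrm (q + k)%N - hrm (q + k)%N.+1) by rewrite /w; ring.
  lra.
apply/eqP => G0.
have g : gauss n z @[n --> \oo] --> (0 : K) by rewrite -G0; exact: gauss_cvg.
move/nm_cvgP: g => /(_ (nm (gauss q.+1 z) / 2)).
have h0 : 0 < nm (gauss q.+1 z) / 2 by rewrite divr_gt0.
move=> /(_ h0)[N _ /(_ (q + N).+1)] /=.
rewrite sub0r nmN => /(_ (leqW (leq_addl _ _))).
have t0 := (@harmonic_ge0 R) (q + N)%N; have Ct := mulr_ge0 C0 t0.
have l1 : 2^-1 <= 1 - 2 * C * (hrm q - hrm (q + N)%N) by lra.
have := ler_wpM2l (ltW g0) l1.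
by have := low N; lra.
Qed.

End ReciprocalGamma.

(** * Hermite interpolation and the functional calculus *)

Section HermiteInterpolation.
Variable K : numClosedFieldType.
Implicit Types (p q r t : {poly K}) (a z : K).

(** Each derivation lowers the multiplicity of the root a by one; the cofactor at
    a is tracked because its nonvanishing drives the Newton step of
    hermite_seq. *)
Lemma derivn_XsubC_exp a k j r : (j <= k)%N ->
  exists2 r', (('X - a%:P) ^+ k * r)^`(j) = ('X - a%:P) ^+ (k - j) * r' &
    r'.[a] = (k ^_ j)%:R * r.[a].
Proof.
elim: j k r => [|j IH] k r jk.
  by exists r; rewrite ?derivn0 ?subn0 // ffactn0 mul1r.
case: k jk => // k jk; rewrite derivSn.
have -> : (('X - a%:P) ^+ k.+1 * r)^`() =
    ('X - a%:P) ^+ k * (r *+ k.+1 + ('X - a%:P) * r^`()).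
  rewrite derivM deriv_exp derivXsubC mul1r exprS mulrDr; congr (_ + _).
    by rewrite mulrnAl mulrnAr.
  by rewrite mulrCA mulrA.
have [r' -> r'a] := IH k (r *+ k.+1 + ('X - a%:P) * r^`()) jk.
exists r' => //; rewrite r'a hornerD hornerM hornerXsubC subrr mul0r addr0.
by rewrite hornerMn ffactSS natrM mulrnAr -mulrA (mulr_natl _ k.+1).
Qed.

(** If (X - a)^k divides t with cofactor r, then the k-th derivative at a is
    k! r(a), so its vanishing gives one more factor X - a. *)
Lemma dvd_XsubC_exp_derivn a k t :
  (forall j, (j < k)%N -> t^`(j).[a] = 0) -> exists r, t = ('X - a%:P) ^+ k * r.
Proof.
elim: k => [|k IH] tj; first by exists t; rewrite mul1r.
have [|r tE] := IH; first by move=> j jk; apply: tj; rewrite ltnW.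
have [r' dE r'a] := derivn_XsubC_exp a r (leqnn k).
have := tj k (ltnSn k); rewrite tE dE subnn mul1r r'a ffactnn => /eqP.
rewrite mulf_eq0 pnatr_eq0 gtn_eqF ?fact_gt0 //= => /eqP ra.
have /factor_theorem[s sE] : root r a by apply/eqP.
by exists s; rewrite exprSr -mulrA [_ * s]mulrC -sE.
Qed.

(** Newton's scheme: adding the point a to s, the polynomial q with root sequence s
    has all earlier data equal to 0 and a nonzero derivative of the new order at a,
    so a multiple of q corrects the new value without disturbing the others. *)
Lemma hermite_seq (d : K -> nat -> K) (s : seq K) :
  exists p, forall z j, (j < count_mem z s)%N -> p^`(j).[z] = d z j.
Proof.
elim: s => [|a s [p IH]]; first by exists 0.
pose q := \prod_(b <- s) ('X - b%:P); set m := count_mem a s.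
have q0 : q != 0 by apply/monic_neq0/monic_prod_XsubC.
have qz z : exists2 r, q = ('X - z%:P) ^+ (count_mem z s) * r & ~~ root r z.
  have [k [r]] := multiplicity_XsubC q z; rewrite q0 /= => rz qE.
  exists r => //; rewrite -mu_prod_XsubC -/q mulrC {1}qE; congr (_ * _ ^+ _).
  by rewrite qE mupMr // mup_XsubCX eqxx.
have [r qE ra] := qz a.
have [r' dE r'a] := derivn_XsubC_exp a r (leqnn m).
have nz : q^`(m).[a] != 0.
  rewrite qE -/m dE subnn mul1r r'a ffactnn.
  by apply: mulf_neq0; [rewrite pnatr_eq0 gtn_eqF ?fact_gt0|exact: ra].
pose c := (d a m - p^`(m).[a]) / q^`(m).[a].
exists (p + c *: q) => z j /=; rewrite derivnD derivnZ hornerD hornerZ.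
have vanish k : (k < count_mem z s)%N -> q^`(k).[z] = 0.
  move=> ks; have [u -> _] := qz z.
  have [u' -> _] := derivn_XsubC_exp z u (ltnW ks).
  by rewrite hornerM horner_exp hornerXsubC subrr expr0n subn_eq0 leqNgt ks mul0r.
case: eqVneq => [/esym az|az] jz; last first.
  by rewrite IH // vanish // mulr0 addr0.
subst z; move: jz; rewrite add1n ltnS leq_eqVlt => /orP[/eqP ->|jz].
  by rewrite -/m /c divfK // subrKC.
by rewrite IH // vanish // mulr0 addr0.
Qed.

Lemma dvdp_prod_mup (s : seq K) t : t != 0 ->
  (forall z, (count_mem z s <= mup z t)%N) -> \prod_(b <- s) ('X - b%:P) %| t.
Proof.
elim: s t => [|a s IH] t t0 le; first by rewrite big_nil dvd1p.
have : ('X - a%:P) ^+ 1 %| t by rewrite -mup_geq // (leq_trans _ (le a)) //= eqxx.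
rewrite expr1 => /dvdpP[u tE]; rewrite big_cons tE mulrC.
have u0 : u != 0 by apply: contra t0 => /eqP u0; rewrite tE u0 mul0r.
apply: dvdp_mul => //; apply: IH => // z.
have := le z; rewrite tE mupM ?polyXsubC_eq0 //= -['X - _]expr1 mup_XsubCX.
by rewrite addnC; case: eqP => _; rewrite ?addn1 ?addn0 ?add1n ?add0n // ltnS.
Qed.

Variable n : nat.
Implicit Types (M : 'M[K]_n.+1) (f g : K -> K).

Lemma mxminpoly_neq0 M : mxminpoly M != 0.
Proof. exact/monic_neq0/mxminpoly_monic. Qed.

Lemma mxminpoly_split M : exists s, mxminpoly M = \prod_(b <- s) ('X - b%:P).
Proof.
have [s sE] := closed_field_poly_normal (mxminpoly M).
by exists s; rewrite sE (monicP (mxminpoly_monic M)) scale1r.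
Qed.

Lemma hermite_exists f M : exists p, hermite_interpolates f M p.
Proof.
have [s sE] := mxminpoly_split M.
have [p hp] := hermite_seq (fun z j => derive1n j f z) s.
by exists p => z j; rewrite sE mu_prod_XsubC; exact: hp.
Qed.

(** The difference of two interpolants vanishes at each eigenvalue to the order of
    its multiplicity in the minimal polynomial, hence is divisible by it. *)
Lemma hermite_unique f M p q : hermite_interpolates f M p ->
  hermite_interpolates f M q -> horner_mx M p = horner_mx M q.
Proof.
move=> hp hq; apply/eqP; rewrite -subr_eq0 -rmorphB /= -dvd_mxminpoly.
have [->|t0] := eqVneq (p - q) 0; first exact: dvdp0.
have [s sE] := mxminpoly_split M; rewrite sE; apply: dvdp_prod_mup => // z.
rewrite mup_geq //.
have [|r ->] := @dvd_XsubC_exp_derivn z (count_mem z s) (p - q).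
  move=> j jz; rewrite derivnB hornerD hornerN hp ?hq ?subrr //;
    by rewrite sE mu_prod_XsubC.
exact: dvdp_mulr.
Qed.

(** Interpolation with respect to any annihilating polynomial suffices, as the
    minimal polynomial divides it.  This avoids computing the minimal polynomial
    of a translate. *)
Lemma mxfun_interp f M P p : P != 0 -> horner_mx M P = 0 ->
  (forall z j, (j < mup z P)%N -> p^`(j).[z] = derive1n j f z) ->
  mxfun f M = horner_mx M p.
Proof.
move=> P0 MP hp; apply: (@hermite_unique f); last first.
  move=> z j jz; apply: hp; apply: leq_trans jz _.
  rewrite mup_geq //; apply: dvdp_trans (mxminpoly_min MP).
  by rewrite -mup_geq ?mxminpoly_neq0.
have [q hq] := hermite_exists f M.
exact: (@xgetPex _ (0 : {poly K}) [set p | hermite_interpolates f M p]) (ex_intro _ q hq).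
Qed.

Lemma mxfun_hermite f M p :
  hermite_interpolates f M p -> mxfun f M = horner_mx M p.
Proof. by move=> hp; apply: mxfun_interp hp; rewrite ?mxminpoly_neq0 ?mx_root_minpoly. Qed.

Lemma mxfun_comm f M (B : 'M[K]_n.+1) : GRing.comm B M -> GRing.comm B (mxfun f M).
Proof. by move=> BM; apply: comm_mx_horner. Qed.

Lemma derive1n_shift f c j z :
  derive1n j (fun w => f (w + c)) z = derive1n j f (z + c).
Proof.
elim: j z => // j IH z; rewrite !derive1nS /derive1.
have -> : (fun w => f (w + c))^`(j)%classic = fun w => derive1n j f (w + c).
  exact/funext.
by under eq_fun do rewrite -addrA.
Qed.

(** If p interpolates the translated function on M, then p(X - c) interpolates f
    with respect to the translate of the minimal polynomial of M, which
    annihilates M + cI. *)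
Lemma mxfun_shift f M c : mxfun f (M + c%:M) = mxfun (fun z => f (z + c)) M.
Proof.
have [p hp] := hermite_exists (fun z => f (z + c)) M.
rewrite (mxfun_hermite hp).
have hc q : horner_mx (M + c%:M) (q \Po ('X - c%:P)) = horner_mx M q.
  elim/poly_ind: q => [|q b IH]; first by rewrite comp_poly0 !rmorph0.
  rewrite comp_polyD comp_polyM comp_polyX comp_polyC !rmorphD !rmorphM /= IH.
  by rewrite !horner_mx_C rmorphB /= !horner_mx_X horner_mx_C addrK.
have dc q j z : (q \Po ('X - c%:P))^`(j).[z] = q^`(j).[z - c].
  elim: j q => [|j IH] q; first by rewrite !derivn0 horner_comp hornerXsubC.
  by rewrite !derivSn deriv_comp derivXsubC mulr1 IH.
have E : ('X - c%:P) \Po ('X + c%:P) = 'X :> {poly K}.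
  by rewrite raddfB /= comp_polyX comp_polyC addrK.
pose P := mxminpoly M \Po ('X - c%:P).
have P0 : P != 0.
  apply: contra (mxminpoly_neq0 M) => /eqP P0; apply/eqP.
  have : P \Po ('X + c%:P) = 0 by rewrite P0 comp_poly0.
  by rewrite /P -comp_polyA E comp_polyXr.
rewrite (@mxfun_interp f (M + c%:M) P (p \Po ('X - c%:P))) //.
  by rewrite hc mx_root_minpoly.
move=> z j jz; rewrite dc hp ?derive1n_shift ?subrK //; apply: leq_trans jz _.
rewrite mup_geq ?mxminpoly_neq0 //.
have : ('X - z%:P) ^+ mup z P %| P by rewrite -mup_geq.
move=> /(dvdp_comp_poly ('X + c%:P)).
rewrite /P -comp_polyA E comp_polyXr.
rewrite rmorphXn /= raddfB /= comp_polyX comp_polyC.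
by rewrite polyCB opprB addrA addrAC.
Qed.

Lemma is_derive_horner p z : is_derive (z : K) (1 : K) (horner p) p^`().[z].
Proof.
elim/poly_ind: p => [|p c IH].
  have -> : horner (0 : {poly K}) = cst 0 by apply/funext => w; rewrite horner0.
  by rewrite deriv0 horner0; exact: is_derive_cst.
have -> : horner (p * 'X + c%:P) = horner p * id + cst c.
  by apply/funext => w; rewrite hornerD hornerMX hornerC.
apply: is_derive_eq.
rewrite derivD derivM derivX derivC !hornerE /=.
by rewrite -[LHS]/(p.[z] * 1 + z * p^`().[z]) mulr1 addrC mulrC.
Qed.

Lemma derive1_horner p : (horner p)^`()%classic = horner p^`().
Proof.
by apply/funext => z; rewrite derive1E; have [_ ->] := is_derive_horner p z.
Qed.

Lemma derive1n_horner p j : derive1n j (horner p) = horner p^`(j).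
Proof.
by elim: j => // j IH; rewrite derive1nS IH derive1_horner derivnS.
Qed.

Lemma mxfun_horner p M : mxfun (horner p) M = horner_mx M p.
Proof. by apply: mxfun_hermite => z j _; rewrite derive1n_horner. Qed.

Lemma root_unitmx_neq M c z : M + c%:M \in unitmx -> root (mxminpoly M) z ->
  z + c != 0.
Proof.
move=> Mc; rewrite -eigenvalue_root_min => /eigenvalueP[v vM v0].
apply: contra v0 => /eqP zc; apply/eqP.
have : v *m (M + c%:M) = 0.
  by rewrite mulmxDr vM mul_mx_scalar -scalerDl zc scale0r.
by move/(congr1 (mulmx^~ (invmx (M + c%:M)))); rewrite mulmxK // mul0mx.
Qed.

End HermiteInterpolation.

(** * Smooth functions of matrices *)

Section SmoothFunctions.
Variable R : realType.
Local Notation K := (cplx R).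
Implicit Types (f g : K -> K) (U : set K) (p q : {poly K}).

(** A record rather than a bare quantified formula: this keeps unification from
    unfolding iterated derivatives when smoothness hypotheses are matched. *)
Record smooth_upto U k f : Prop := SmoothUpto {
  smoothP : forall j z, (j <= k)%N -> U z -> derivable (derive1n j f) z 1 }.

Lemma smooth0 U k f z : smooth_upto U k f -> U z -> derivable f z 1.
Proof. by move=> sf; apply: (smoothP sf (j := 0)). Qed.

(** Derivatives are local; openness of U lets the equality be differentiated
    again. *)
Lemma eq_on_derive1n U f g : open U -> (forall z, U z -> f z = g z) ->
  forall j z, U z -> derive1n j f z = derive1n j g z.
Proof.
move=> oU fg; elim=> [|j IH] z Uz; first exact: fg.
rewrite !derive1nS !derive1E; apply: near_eq_derive.
by have : \forall w \near z, U w by [apply: open_nbhs_nbhs]; apply: filterS => w; exact: IH.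
Qed.

Lemma near_open U z (P : K -> Prop) : open U -> U z ->
  (forall w, U w -> P w) -> \forall w \near z, P w.
Proof.
move=> oU Uz UP; have : \forall w \near z, U w by apply: open_nbhs_nbhs.
exact: filterS.
Qed.

Lemma eq_on_smooth U k f g : open U -> (forall z, U z -> f z = g z) ->
  smooth_upto U k f -> smooth_upto U k g.
Proof.
move=> oU fg sf; split=> j z jk Uz.
apply: near_eq_derivable (smoothP sf jk Uz).
by apply: (near_open oU Uz) => w; exact: eq_on_derive1n.
Qed.

Lemma smoothS U k f : (forall z, U z -> derivable f z 1) ->
  smooth_upto U k f^`()%classic -> smooth_upto U k.+1 f.
Proof.
move=> df sf; split=> -[|j] z jk Uz; first exact: df.
by rewrite derive1Sn; exact: (smoothP sf).
Qed.

Lemma smooth_derive1 U k f : smooth_upto U k.+1 f -> smooth_upto U k f^`()%classic.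
Proof. by move=> sf; split=> j z jk Uz; rewrite -derive1Sn; exact: (smoothP sf). Qed.

Lemma smoothW U k f : smooth_upto U k.+1 f -> smooth_upto U k f.
Proof. by move=> sf; split=> j z jk Uz; apply: (smoothP sf) => //; exact: leqW. Qed.

Lemma derive1nD U k f g : open U -> smooth_upto U k f -> smooth_upto U k g ->
  forall j z, (j <= k.+1)%N -> U z ->
  derive1n j (f + g) z = derive1n j f z + derive1n j g z.
Proof.
move=> oU sf sg; elim=> [|j IH] z jk Uz //.
rewrite !derive1nS !derive1E.
rewrite -deriveD; [|exact: (smoothP sf)|exact: (smoothP sg)].
apply: near_eq_derive; apply: (near_open oU Uz) => w Uw.
by apply: IH; [exact: ltnW|].
Qed.

Lemma smoothD U k f g : open U -> smooth_upto U k f -> smooth_upto U k g ->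
  smooth_upto U k (f + g).
Proof.
move=> oU sf sg; split=> j z jk Uz.
have : derivable (derive1n j f + derive1n j g) z 1.
  by apply: derivableD; [exact: (smoothP sf)|exact: (smoothP sg)].
apply: near_eq_derivable; apply: (near_open oU Uz) => w Uw.
by rewrite (derive1nD oU sf sg) //; exact: leqW.
Qed.

Lemma derive1nN U k f : open U -> smooth_upto U k f ->
  forall j z, (j <= k.+1)%N -> U z -> derive1n j (- f) z = - derive1n j f z.
Proof.
move=> oU sf; elim=> [|j IH] z jk Uz //.
rewrite !derive1nS !derive1E -deriveN; last exact: (smoothP sf).
apply: near_eq_derive; apply: (near_open oU Uz) => w Uw.
by apply: IH; [exact: ltnW|].
Qed.

Lemma smoothN U k f : open U -> smooth_upto U k f -> smooth_upto U k (- f).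
Proof.
move=> oU sf; split=> j z jk Uz.
have : derivable (- derive1n j f) z 1 by apply: derivableN; exact: (smoothP sf).
apply: near_eq_derivable; apply: (near_open oU Uz) => w Uw.
by rewrite (derive1nN oU sf) //; exact: leqW.
Qed.

Lemma derive1M U k f g z : smooth_upto U k f -> smooth_upto U k g -> U z ->
  (f * g)^`()%classic z = (f^`()%classic * g + f * g^`()%classic) z.
Proof.
move=> sf sg Uz; rewrite derive1E deriveM; [|exact: (smooth0 sf)|exact: (smooth0 sg)].
by rewrite -!derive1E addrC; congr (_ + _); exact: mulrC.
Qed.

(** Induction on the order through (fg)' = f'g + fg', an equality on U only. *)
Lemma smoothM U k f g : open U -> smooth_upto U k f -> smooth_upto U k g ->
  smooth_upto U k (f * g).
Proof.
move=> oU; elim: k f g => [|k IH] f g sf sg.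
  split=> -[|//] z _ Uz.
  by apply: derivableM; [exact: (smooth0 sf)|exact: (smooth0 sg)].
apply: smoothS.
  by move=> z Uz; apply: derivableM; [exact: (smooth0 sf)|exact: (smooth0 sg)].
apply: (@eq_on_smooth _ _ (f^`()%classic * g + f * g^`()%classic) _ oU).
  by move=> z Uz; rewrite (derive1M sf sg).
apply: (smoothD oU).
  by apply: IH; [exact: (smooth_derive1 sf)|exact: (smoothW sg)].
by apply: IH; [exact: (smoothW sf)|exact: (smooth_derive1 sg)].
Qed.

(** Induction on the order through (1/f)' = - f' (1/f)^2. *)
Lemma smoothV U k f : open U -> (forall z, U z -> f z != 0) ->
  smooth_upto U k f -> smooth_upto U k (fun z => (f z)^-1).
Proof.
move=> oU f0; elim: k => [|k IH] sf.
  split=> -[|//] z _ Uz.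
  by apply: derivableV; [exact: f0|exact: (smooth0 sf)].
apply: smoothS.
  by move=> z Uz; apply: derivableV; [exact: f0|exact: (smooth0 sf)].
pose g : K -> K := fun z => (f z)^-1.
apply: (@eq_on_smooth _ _ (- (f^`()%classic * (g * g))) _ oU).
  move=> z Uz; rewrite derive1E deriveV; [|exact: f0|exact: (smooth0 sf)].
  rewrite -derive1E -[RHS]/(- (f z ^- 2) * f^`()%classic z).
  rewrite -[LHS]/(- (f^`()%classic z * (g z * g z))) mulNr [in RHS]mulrC.
  by rewrite expr2 invfM.
have sg : smooth_upto U k g by apply: IH; exact: (smoothW sf).
apply: (smoothN oU); apply: (smoothM oU); first exact: (smooth_derive1 sf).
exact: (smoothM oU sg sg).
Qed.

(** Leibniz' rule without its binomial coefficients: both sides obey the same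
    product rule, so induction on the order suffices. *)
Lemma interpM U f g p q z j : open U -> U z ->
  smooth_upto U j f -> smooth_upto U j g ->
  (forall i, (i <= j)%N -> p^`(i).[z] = derive1n i f z) ->
  (forall i, (i <= j)%N -> q^`(i).[z] = derive1n i g z) ->
  (p * q)^`(j).[z] = derive1n j (f * g) z.
Proof.
move=> oU Uz; elim: j f g p q => [|j IH] f g p q sf sg hp hq.
  by rewrite derivn0 hornerM -[p]derivn0 -[q]derivn0 hp // hq.
rewrite derivSn derive1Sn derivM derivnD hornerD.
have dM := @derive1M U _ f g _ sf sg.
rewrite (eq_on_derive1n oU dM _ Uz).
have s1 : smooth_upto U j (f^`()%classic * g).
  exact: (smoothM oU (smooth_derive1 sf) (smoothW sg)).
have s2 : smooth_upto U j (f * g^`()%classic).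
  exact: (smoothM oU (smoothW sf) (smooth_derive1 sg)).
rewrite (derive1nD oU s1 s2 (leqnSn _) Uz); congr (_ + _); apply: IH.
- exact: (smooth_derive1 sf).
- exact: (smoothW sg).
- by move=> i ij; rewrite -derivSn -derive1Sn hp.
- by move=> i ij; rewrite hq // leqW.
- exact: (smoothW sf).
- exact: (smooth_derive1 sg).
- by move=> i ij; rewrite hp // leqW.
- by move=> i ij; rewrite -derivSn -derive1Sn hq.
Qed.

Variable n : nat.
Implicit Types M : 'M[K]_n.+1.

Definition spectrum_in U M := forall z, root (mxminpoly M) z -> U z.

Lemma mxfunM U f g M : open U -> spectrum_in U M ->
  (forall k, smooth_upto U k f) -> (forall k, smooth_upto U k g) ->
  mxfun (f * g) M = mxfun f M * mxfun g M.
Proof.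
move=> oU sU sf sg.
have [p hp] := hermite_exists f M; have [q hq] := hermite_exists g M.
rewrite (mxfun_hermite hp) (mxfun_hermite hq) -rmorphM /=.
apply: mxfun_hermite => z j jz; apply: (interpM oU _ (sf j) (sg j)).
- apply: sU; rewrite -dvdp_XsubCl XsubC_dvd ?mxminpoly_neq0 //.
  exact: leq_ltn_trans jz.
- by move=> i ij; apply: hp; exact: leq_ltn_trans jz.
- by move=> i ij; apply: hq; exact: leq_ltn_trans jz.
Qed.

Lemma eq_on_mxfun U f g M : open U -> spectrum_in U M ->
  (forall z, U z -> f z = g z) -> mxfun f M = mxfun g M.
Proof.
move=> oU sU fg; have [p hp] := hermite_exists f M.
rewrite (mxfun_hermite hp); apply/esym/mxfun_hermite => z j jz.
rewrite hp //; apply: (eq_on_derive1n oU) => //; apply: sU.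
rewrite -dvdp_XsubCl XsubC_dvd ?mxminpoly_neq0 //.
exact: leq_ltn_trans jz.
Qed.

Lemma crGamma_smooth_upto U k : smooth_upto U k (@crGamma R).
Proof. by split=> j z _ _; exact: crGamma_smooth. Qed.

(** The scalar equation rGamma(z) = z rGamma(z+1) transported by the functional
    calculus. *)
Lemma mxrGamma_rec M : mxrGamma M = M * mxrGamma (M + 1%:M).
Proof.
rewrite /mxrGamma mxfun_shift -{2}[M]horner_mx_X -mxfun_horner.
have sX k : smooth_upto [set: K] k (horner 'X).
  by split=> j z _ _; rewrite derive1n_horner; have [] := is_derive_horner (('X : {poly K})^`(j)) z.
have sG k : smooth_upto [set: K] k (fun z => crGamma (z + 1)).
  split=> j z _ _; have := @crGamma_smooth R j (z + 1).
  have -> : derive1n j (fun w => crGamma (w + 1)) =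
      fun w => derive1n j (@crGamma R) (w + 1).
    by apply/funext => w; rewrite derive1n_shift.
  rewrite /derivable; set F := (X in cvg (X @ _)) => h; set G := (X in cvg (X @ _)).
  suff -> : G = F by [].
  by apply/funext => h0; rewrite /F /G /= addrA.
rewrite -(@mxfunM setT) //; last exact: openT.
congr (mxfun _ M); apply/funext => z.
by rewrite -[RHS]/(('X : {poly K}).[z] * crGamma (z + 1)) hornerX crGamma_shift.
Qed.

(** No eigenvalue of M is a pole of the gamma function. *)
Definition gamma_regular M := forall j : nat, M + j%:R%:M \in unitmx.

Lemma crGamma_continuous : continuous (@crGamma R).
Proof.
move=> z; apply: differentiable_continuous; apply/derivable1_diffP.
exact: (@crGamma_smooth R 0%N z).
Qed.

(** rGamma and its inverse are smooth on the open set where rGamma does not vanish,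
    which contains the spectrum, and their product is 1 there. *)
Lemma mxrGammaK M : gamma_regular M -> mxrGamma M * mxGamma M = 1.
Proof.
move=> hM; (* cGamma takes junk values outside U *)
pose U : set K := [set z | crGamma z != 0].
have oU : open U.
  have -> : U = @crGamma R @^-1` [set w | w != 0] by [].
  apply: open_comp; first by move=> z _; exact: crGamma_continuous.
  have -> : [set w : K | w != 0] = ~` [set 0].
    by apply/seteqP; split=> w /= /eqP.
  rewrite openC; apply: accessible_closed_set1.
  by apply: hausdorff_accessible; exact: norm_hausdorff.
have sU : spectrum_in U M.
  by move=> z zM; apply: crGamma_neq0 => j; exact: root_unitmx_neq zM.
rewrite /mxrGamma /mxGamma -(mxfunM oU sU).
- rewrite (@eq_on_mxfun U _ (horner 1)) ?mxfun_horner ?rmorph1 //.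
  by move=> z Uz; rewrite hornerC /cGamma -[LHS]/(crGamma z / crGamma z) divff.
- by move=> k; exact: crGamma_smooth_upto.
move=> k; apply: (smoothV oU); last exact: crGamma_smooth_upto.
by move=> z Uz; exact: Uz.
Qed.

End SmoothFunctions.

(** * Reordering commuting products *)

Section Regrouping.
Variable T : nzRingType.
Implicit Types s t : seq T.

Lemma perm_prod_comm s t : {in s &, forall x y, GRing.comm x y} ->
  perm_eq s t -> \prod_(x <- s) x = \prod_(x <- t) x.
Proof.
elim: s t => [|x s IH] t cs st.
  by have /perm_nilP -> : perm_eq t [::] by rewrite perm_sym.
have xt : x \in t by rewrite -(perm_mem st) mem_head.
case/splitPr: xt st => t1 t2 st.
have st' : perm_eq s (t1 ++ t2).
  by rewrite -(perm_cons x); apply: perm_trans st _; rewrite -[x :: t2]cat1s perm_catCA.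
rewrite big_cons (IH (t1 ++ t2)) //; last first.
  by move=> y z ys zs; apply: cs; rewrite inE ?ys ?zs orbT.
have xt1 : GRing.comm x (\prod_(y <- t1) y).
  rewrite big_seq; apply: commr_prod => y yt; apply: cs; rewrite ?mem_head //.
  by rewrite (perm_mem st) mem_cat yt.
by rewrite !big_cat /= big_cons !mulrA xt1.
Qed.

Variables a b c d e f g h : T.
Hypothesis comm8 : {in [:: a; b; c; d; e; f; g; h] &, forall x y, GRing.comm x y}.

(** The factors of the terms of the four series are brought into the order powers
    of x, gamma factor common to all terms, cancelling gamma factors, and the
    rest.  An abstract ring keeps the rewriting cheap. *)
Lemma regroup1 :
  a * b * c * d * e * (f * g * h) = (a * g) * d * (f * e) * (b * c * h).
Proof.
have E : perm_eq [:: a; b; c; d; e; f; g; h] [:: a; g; d; f; e; b; c; h].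
  by apply/permP => p /=; lia.
by have := perm_prod_comm comm8 E; rewrite !big_cons !big_nil !mulr1 !mulrA.
Qed.

Lemma regroup2 :
  a * b * c * d * e * (f * g * h) = (c * g) * d * (f * e) * (a * b * h).
Proof.
have E : perm_eq [:: a; b; c; d; e; f; g; h] [:: c; g; d; f; e; a; b; h].
  by apply/permP => p /=; lia.
by have := perm_prod_comm comm8 E; rewrite !big_cons !big_nil !mulr1 !mulrA.
Qed.

Lemma regroup3 :
  a * b * c * d * e * (f * (g * h)) = (a * f) * d * (h * e) * (b * c * g).
Proof.
have E : perm_eq [:: a; b; c; d; e; f; g; h] [:: a; f; d; h; e; b; c; g].
  by apply/permP => p /=; lia.
by have := perm_prod_comm comm8 E; rewrite !big_cons !big_nil !mulr1 !mulrA.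
Qed.

Lemma regroup4 :
  a * b * c * d * e * (f * (g * h)) = (b * f) * d * (h * e) * (a * c * g).
Proof.
have E : perm_eq [:: a; b; c; d; e; f; g; h] [:: b; f; d; h; e; a; c; g].
  by apply/permP => p /=; lia.
by have := perm_prod_comm comm8 E; rewrite !big_cons !big_nil !mulr1 !mulrA.
Qed.

End Regrouping.

(** * Commutation with a fixed matrix *)

Section CommutingMatrices.
Variables (R : realType) (n : nat).
Local Notation K := (cplx R).
Implicit Types (A B M N : 'M[K]_n.+1).

(** M lies in the bicommutant of A.  Membership is inherited by sums, products,
    inverses, functional calculus and limits, and any two members commute. *)
Definition bicomm A M := forall B, GRing.comm B A -> GRing.comm B M.

Lemma bicomm_refl A : bicomm A A.
Proof. by []. Qed.

Lemma bicomm_comm A M N : bicomm A M -> bicomm A N -> GRing.comm M N.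
Proof. by move=> AM AN; apply: AN; apply/commr_sym; exact: AM. Qed.

Lemma bicommD A M N : bicomm A M -> bicomm A N -> bicomm A (M + N).
Proof. by move=> AM AN B BA; apply: commrD; [exact: AM|exact: AN]. Qed.

Lemma bicommN A M : bicomm A M -> bicomm A (- M).
Proof. by move=> AM B BA; apply: commrN; exact: AM. Qed.

Lemma bicommM A M N : bicomm A M -> bicomm A N -> bicomm A (M * N).
Proof. by move=> AM AN B BA; apply: commrM; [exact: AM|exact: AN]. Qed.

Lemma bicommV A M : bicomm A M -> bicomm A M^-1.
Proof. by move=> AM B BA; apply: commrV; exact: AM. Qed.

Lemma bicommZ A M (c : K) : bicomm A M -> bicomm A (c *: M).
Proof. by move=> AM B BA; rewrite /GRing.comm -scalerAr -scalerAl AM. Qed.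

Lemma bicomm_scalar A (c : K) : bicomm A c%:M.
Proof. by move=> B _; rewrite -scalemx1; apply: bicommZ => // C _; exact: commr1. Qed.

Lemma bicomm_poch A M k : bicomm A M -> bicomm A (mxpoch M k).
Proof.
move=> AM B BA; apply: commr_prod => j _; apply: commrD; first exact: AM.
exact: bicomm_scalar BA.
Qed.

Lemma bicomm_mxfun f A M : bicomm A M -> bicomm A (mxfun f M).
Proof. by move=> AM B BA; apply: mxfun_comm; exact: AM. Qed.

Lemma bicomm_lim A (u : nat -> 'M[K]_n.+1) l : (forall k, bicomm A (u k)) ->
  series u @ \oo --> l -> bicomm A l.
Proof.
move=> Au ul B BA; apply: (comm_lim _ ul) => k.
by rewrite /series /=; apply: commr_sum => i _; exact: Au.
Qed.

Lemma bicomm_in A (s : seq 'M[K]_n.+1) :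
  {in s, forall M, bicomm A M} -> {in s &, forall M N, GRing.comm M N}.
Proof. by move=> sA M N Ms Ns; apply: bicomm_comm (sA M Ms) (sA N Ns). Qed.

End CommutingMatrices.

(** * Matrix exponentials and powers *)

Section MatrixPowers.
Variables (R : realType) (n : nat).
Local Notation K := (cplx R).
Implicit Types (A B M N : 'M[K]_n.+1) (x c : K).

Lemma mnmX M k : mnm (M ^+ k) <= mnm (1 : 'M[K]_n.+1) * mnm M ^+ k.
Proof.
elim: k => [|k IH]; first by rewrite !expr0 mulr1.
rewrite exprSr; apply: le_trans (mnmM _ _) _.
by rewrite exprSr mulrA; apply: ler_wpM2r => //; exact: mnm_ge0.
Qed.

Lemma mxexp_term_geo M : exists D, forall k,
  mnm ((k`!%:R : K)^-1 *: M ^+ k) <= D * 2^-1 ^+ k.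
Proof.
have [D hD] := exp_coeff_geo (mnm_ge0 M).
exists (mnm (1 : 'M[K]_n.+1) * D) => k; rewrite mnmZ nmV nm_nat mulrC.
have h := ler_wpM2l (mnm_ge0 (1 : 'M[K]_n.+1)) (hD k).
rewrite -[leRHS]mulrA; apply: le_trans h.
by rewrite mulrA; apply: ler_wpM2r; [rewrite invr_ge0|exact: mnmX].
Qed.

Lemma mxexp_cvg M : series (fun k => (k`!%:R : K)^-1 *: M ^+ k) @ \oo --> mxexp M.
Proof.
have [D hD] := mxexp_term_geo M.
apply: (geo_cvg (@mx_abs_complete R _ _) (D := D)) => k.
by apply: le_trans (nm_mnm _) (hD k).
Qed.

Lemma mx_cvg_unique (u : nat -> 'M[K]_n.+1) (l l' : 'M[K]_n.+1) :
  u @ \oo --> l -> u @ \oo --> l' -> l = l'.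
Proof. by move=> h h'; apply: (cvg_unique _ h h'); exact: norm_hausdorff. Qed.

Lemma bicomm_mxexp A M : bicomm A M -> bicomm A (mxexp M).
Proof.
move=> AM; apply: (bicomm_lim _ (mxexp_cvg (M := M))) => k; apply: bicommZ.
by move=> B BA; apply: commrX; exact: AM.
Qed.

Lemma scaler_mulmx (a b : K) M N : (a *: M) * (b *: N) = (a * b) *: (M * N).
Proof.
have -> : (a *: M) * (b *: N) = a *: (M * (b *: N)) by rewrite scalerAl.
by rewrite -scalerAr scalerA.
Qed.

(** The double series of M^k / k! and N^m / m!, summed by rows and by antidiagonals,
    the latter with the binomial formula. *)
Lemma mxexpD M N : GRing.comm M N -> mxexp (M + N) = mxexp M * mxexp N.
Proof.
move=> MN.
pose u k := (k`!%:R : K)^-1 *: M ^+ k; pose v k := (k`!%:R : K)^-1 *: N ^+ k.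
have [D hD] := mxexp_term_geo M; have [E hE] := mxexp_term_geo N.
have S1 : series (fun k => u k * mxexp N) @ \oo --> mxexp M * mxexp N.
  by apply: cvg_series_mulmxr; exact: mxexp_cvg.
suff S2 : series (fun k => u k * mxexp N) @ \oo --> mxexp (M + N).
  exact: (mx_cvg_unique S2 S1).
apply: (double_series (a := fun k m => u k * v m) (D := D * E)).
- move=> k m; apply: le_trans (nm_mnm _) _; apply: le_trans (mnmM _ _) _.
  rewrite exprD [leRHS]mulrACA; apply: ler_pM; [exact: mnm_ge0|exact: mnm_ge0|exact: hD|exact: hE].
- by move=> k; apply: cvg_series_mulmxl; exact: mxexp_cvg.
rewrite (_ : (fun m => \sum_(k < _) _) = fun m => (m`!%:R : K)^-1 *: (M + N) ^+ m).
  exact: mxexp_cvg.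
apply/funext => m; rewrite addrC (exprDn_comm _ (commr_sym MN)) scaler_sumr.
apply: eq_bigr => k _; have km : (k <= m)%N by rewrite -ltnS.
rewrite /u /v scaler_mulmx -[X in _ = _ *: X]scaler_nat scalerA.
have MNk : M ^+ k * N ^+ (m - k) = N ^+ (m - k) * M ^+ k.
  by apply: commrX; apply/commr_sym; apply: commrX; apply/commr_sym.
rewrite MNk; congr (_ *: _); rewrite -(bin_fact km) !natrM.
have f0 i : (i`!%:R : K) != 0 by rewrite pnatr_eq0 -lt0n fact_gt0.
have b0 : ('C(m, k)%:R : K) != 0 by rewrite pnatr_eq0 -lt0n bin_gt0.
by field; rewrite !f0 b0.
Qed.

Lemma scalar_mx_exp c k : (c%:M : 'M[K]_n.+1) ^+ k = (c ^+ k)%:M.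
Proof. by rewrite -rmorphXn. Qed.

Lemma mxexp_scalar c : mxexp (c%:M : 'M[K]_n.+1) = (cexp c)%:M.
Proof.
suff S1 : series (fun k => (k`!%:R : K)^-1 *: (c%:M : 'M[K]_n.+1) ^+ k) @ \oo --> (cexp c)%:M.
  exact: (mx_cvg_unique (@mxexp_cvg c%:M) S1).
have /nm_cvgP h := @cexp_series R c.
have s : (fun k => nm (cexp c - series (fun k => c ^+ k / k`!%:R) k) *
    nm (1 : 'M[K]_n.+1)) @ \oo --> (0 : R).
  rewrite [X in _ --> X](_ : 0 = 0 * nm (1 : 'M[K]_n.+1)); last by rewrite mul0r.
  apply: cvgMr_tmp; apply/cvgrPdist_lt => e e0; apply: filterS (h e e0) => k.
  by rewrite sub0r normrN ger0_norm ?nm_ge0.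
apply: (nm_squeeze _ s); near=> k.
rewrite -nmZ -scalemx1 (_ : series _ k = series (fun k => c ^+ k / k`!%:R) k *: 1).
  by rewrite scalerBl lexx.
rewrite /series /= scaler_suml; apply: eq_bigr => i _.
by rewrite scalar_mx_exp -scalemx1 scalerA mulrC.
Unshelve. all: by end_near. Qed.

Lemma mxexpN M : mxexp (- M) * mxexp M = 1.
Proof.
rewrite -mxexpD; last by apply/commr_sym; apply: commrN.
by rewrite addNr -(scale0r 1) scalemx1 mxexp_scalar cexp0.
Qed.

(** Multiplication by r > 0 does not change the principal argument. *)
Lemma clnM (r : R) x : 0 < r -> x != 0 -> cln (r%:C * x) = cln x + (ln r)%:C.
Proof.
move=> r0; case: x => a b x0.
have nE : Normc.normc (r%:C * (a +i* b)) = r * Normc.normc (a +i* b).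
  by rewrite -[LHS]/(nm (r%:C * (a +i* b) : K)) nmM nmC gtr0_norm.
have n0 : 0 < Normc.normc (a +i* b).
  rewrite -[Normc.normc _]/(nm (a +i* b : K)) lt_neqAle nm_ge0 andbT eq_sym.
  by apply: contra x0 => /eqP/nm_eq0->.
rewrite /cln nE lnM ?posrE // /carg nE.
have -> : (r%:C * (a +i* b) : K) = (r * a) +i* (r * b) by simpc.
rewrite /= pmulr_rge0 // -mulf_div divff ?gt_eqF // mul1r.
by simpc; congr (_ +i* _); rewrite addrC.
Qed.

Lemma bicomm_mxpow A M x : bicomm A M -> bicomm A (mxpow x M).
Proof. by move=> AM; apply: bicomm_mxexp; exact: bicommZ. Qed.

Lemma mxpowS M x : x != 0 -> mxpow x (M + 1%:M) = x *: mxpow x M.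
Proof.
move=> x0; rewrite /mxpow scalerDr mxexpD; last first.
  apply: (@bicomm_comm _ _ M); apply: bicommZ; last exact: bicomm_scalar.
  exact: bicomm_refl.

by rewrite scale_scalar_mx mulr1 mxexp_scalar clnK // -scalemx1 -scalerAr mulr1.
Qed.

Lemma mxpow_nat M x k : x != 0 -> mxpow x (M + k%:R%:M) = x ^+ k *: mxpow x M.
Proof.
move=> x0; elim: k => [|k IH]; first by rewrite raddf0 addr0 expr0 scale1r.
have -> : k.+1%:R%:M = k%:R%:M + 1%:M :> 'M[K]_n.+1 by rewrite -natr1 raddfD.
rewrite addrA.
rewrite (mxpowS _ x0).
rewrite IH.
by rewrite scalerA -exprS.
Qed.

(** cln (2x) + cln (x/2) = 2 cln x, the two real logarithms cancelling. *)
Lemma mxpow_double M x : x != 0 -> mxpow (2 * x) M * mxpow (x / 2) M = mxpow x (2 *: M).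
Proof.
move=> x0; rewrite /mxpow -mxexpD; last first.
  by apply: (@bicomm_comm _ _ M); exact: bicommZ.
rewrite -scalerDl scalerA.
suff -> : cln (2 * x) + cln (x / 2) = cln x * 2 by [].
have e1 : 2 * x = (2 : R)%:C * x by congr (_ * _); rewrite rmorph_nat.
have e2 : x / 2 = (2^-1 : R)%:C * x.
  by rewrite mulrC; congr (_ * _); rewrite fmorphV rmorph_nat.
rewrite e1 e2 !clnM //; try by rewrite ?invr_gt0.
rewrite lnV ?posrE // rmorphN /=.
by rewrite addrACA subrr addr0 mulr_natr mulr2n.
Qed.

Lemma mxpowN M x : mxpow x (- M) * mxpow x M = 1.
Proof. by rewrite /mxpow scalerN mxexpN. Qed.

End MatrixPowers.

(** * Pochhammer products *)

Section Pochhammer.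
Variables (R : realType) (n : nat).
Local Notation K := (cplx R).
Implicit Types (A B C M N : 'M[K]_n.+1) (x c w : K).

Lemma mxpoch0 M : mxpoch M 0 = 1.
Proof. by rewrite /mxpoch big_ord0. Qed.

Lemma mxpochS M k : mxpoch M k.+1 = mxpoch M k * (M + k%:R%:M).
Proof. by rewrite /mxpoch big_ord_recr. Qed.

Lemma natmxD i j : (i + j)%:R%:M = i%:R%:M + j%:R%:M :> 'M[K]_n.+1.
Proof. by rewrite natrD raddfD. Qed.

Lemma mxpochD M k m : mxpoch M (k + m) = mxpoch M k * mxpoch (M + k%:R%:M) m.
Proof.
elim: m => [|m IH]; first by rewrite addn0 mxpoch0 mulr1.
by rewrite addnS !mxpochS IH -mulrA -addrA -natmxD.
Qed.

Lemma mxpochSl M k : mxpoch M k.+1 = M * mxpoch (M + 1%:M) k.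
Proof.
by rewrite -[k.+1]add1n mxpochD mxpochS mxpoch0 mul1r raddf0 addr0.
Qed.

Lemma gamma_regularD M k : gamma_regular M -> gamma_regular (M + k%:R%:M).
Proof. by move=> hM j; rewrite -addrA -natmxD. Qed.

Lemma gamma_regular1 M : gamma_regular M -> gamma_regular (M + 1%:M).
Proof. exact: (@gamma_regularD M 1). Qed.

Lemma mxpoch_unit M k : gamma_regular M -> mxpoch M k \is a GRing.unit.
Proof.
move=> hM; elim: k => [|k IH]; first by rewrite mxpoch0 unitr1.
by rewrite mxpochS unitrMl //; exact: hM.
Qed.

Lemma bicomm_poch_shift M c k : bicomm M (mxpoch (M + c%:M) k).
Proof.
apply: bicomm_poch; apply: bicommD; first exact: bicomm_refl.
exact: bicomm_scalar.
Qed.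

Lemma bicomm_shift M c : bicomm M (M + c%:M).
Proof. by apply: bicommD; [exact: bicomm_refl|exact: bicomm_scalar]. Qed.

Lemma mxpoch_invD M k m : gamma_regular M ->
  (mxpoch M (k + m))^-1 = (mxpoch M k)^-1 * (mxpoch (M + k%:R%:M) m)^-1.
Proof.
move=> hM; have u1 := mxpoch_unit k hM.
have u2 := mxpoch_unit m (gamma_regularD k hM).
rewrite mxpochD (invrM u1 u2).
apply: (@bicomm_comm _ _ M); apply: bicommV; first exact: bicomm_poch_shift.
by apply: bicomm_poch; exact: bicomm_refl.
Qed.

(** Each factor M + kI has norm at most (k+1) rho. *)
Lemma mnm_poch M : exists2 rho : R, 1 <= rho & forall k,
  mnm (mxpoch M k) <= mnm (1 : 'M[K]_n.+1) * (k`!%:R * rho ^+ k).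
Proof.
have M0 := mnm_ge0 M; have o0 := mnm_ge0 (1 : 'M[K]_n.+1).
exists (mnm M + mnm (1 : 'M[K]_n.+1) + 1); first by lra.
set rho := _ + 1; have r0 : 0 <= rho by rewrite /rho; lra.
elim=> [|k IH]; first by rewrite mxpoch0 fact0 expr0 !mulr1.
rewrite mxpochS; apply: le_trans (mnmM _ _) _.
rewrite factS exprS mulnC natrM.
have -> : mnm (1 : 'M[K]_n.+1) * (k`!%:R * k.+1%:R * (rho * rho ^+ k)) =
  (mnm (1 : 'M[K]_n.+1) * (k`!%:R * rho ^+ k)) * (k.+1%:R * rho) by ring.
apply: ler_pM; [exact: mnm_ge0|exact: mnm_ge0|exact: IH|].
apply: le_trans (mnmD _ _) _; rewrite mnm_scalar nm_nat.
have k1 : 1 <= (k.+1%:R : R) by rewrite ler1n.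
have h1 : mnm M <= k.+1%:R * mnm M by rewrite ler_peMl.
have h2 : mnm (1 : 'M[K]_n.+1) * k%:R <= k.+1%:R * mnm (1 : 'M[K]_n.+1).
  by rewrite mulrC; apply: ler_wpM2r => //; rewrite ler_nat.
by rewrite /rho; lra.
Qed.

(** For X = (M + kI)^-1 one has k X = I - M X, so |X| <= |I| / (k - |M|): the factors
    of the inverse product tend to 0, and the product decays faster than any
    geometric sequence. *)
Lemma mnm_poch_inv M (rho : R) : gamma_regular M -> 0 <= rho ->
  exists D, forall k, rho ^+ k * mnm (mxpoch M k)^-1 <= D * 2^-1 ^+ k.
Proof.
move=> hM r0; pose e k := (2 * rho) ^+ k * mnm (mxpoch M k)^-1.
have e0 k : 0 <= e k.
  by apply: mulr_ge0; [apply: exprn_ge0; lra|exact: mnm_ge0].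
have o0 := mnm_ge0 (1 : 'M[K]_n.+1); set o := mnm (1 : 'M[K]_n.+1) in o0.
have step k : mnm M + 2 * rho * o + 1 <= k%:R -> e k.+1 <= e k.
  move=> kbig; set X := (M + k%:R%:M)^-1.
  have X0 := mnm_ge0 X.
  have kX : (k%:R - mnm M) * mnm X <= o.
    have E : k%:R *: X = 1 - M * X.
      have : (M + k%:R%:M) * X = 1 by rewrite /X mulrV //; exact: hM.
      by rewrite mulrDl -scalemx1 -scalerAl mul1r => <-; rewrite addrAC subrr add0r.
    have := mnmD 1 (- (M * X)); rewrite -E mnmZ nm_nat mnmN -/o.
    by have := mnmM M X; lra.
  have rX : 2 * rho * mnm X <= 1.
    have k0 : 0 < k%:R - mnm M.
      have := mulr_ge0 (mulr_ge0 (ler0n R 2) r0) o0; lra.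
    have M0 := mnm_ge0 M.
    have h : 2 * rho * ((k%:R - mnm M) * mnm X) <= 2 * rho * o.
      by apply: ler_wpM2l kX; lra.
    rewrite -(ler_pM2l k0); lra.
  rewrite /e mxpochS (invrM (mxpoch_unit k hM) (hM k)).
  rewrite -/X exprS.
  have := mnmM X (mxpoch M k)^-1.
  set Y := mnm (mxpoch M k)^-1; set P := (2 * rho) ^+ k => h.
  have P0 : 0 <= P by apply: exprn_ge0; lra.
  have Y0 : 0 <= Y by exact: mnm_ge0.
  have PY := mulr_ge0 P0 Y0.
  apply: le_trans (_ : (2 * rho * mnm X) * (P * Y) <= _); last first.
    by rewrite ler_piMl.
  have -> : 2 * rho * mnm X * (P * Y) = 2 * rho * P * (mnm X * Y) by ring.
  by apply: ler_wpM2l => //; rewrite !mulr_ge0.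
have [k0 hk0] : exists k0 : nat, mnm M + 2 * rho * o + 1 <= k0%:R.
  have := archi_boundP (_ : 0 <= mnm M + 2 * rho * o + 1).
  set b := Num.bound _ => h; exists b; apply/ltW/h.
  by have := mulr_ge0 (mulr_ge0 (ler0n R 2) r0) o0; have := mnm_ge0 M; lra.
(* e decreases from k0 on, so the sum of its first values bounds it *)
pose D := \sum_(i < k0.+1) e i; exists D.
have bnd k : e k <= D.
  case: (leqP k k0) => kk0.
    have kk : (k < k0.+1)%N by [].
    rewrite /D (bigD1 (Ordinal kk)) //= lerDl.
    by apply: sumr_ge0 => i _; exact: e0.
  rewrite -(subnKC (ltnW kk0)); elim: (k - k0)%N => [|m IH].
    rewrite addn0 /D big_ord_recr /= lerDr.
    by apply: sumr_ge0 => i _; exact: e0.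
  rewrite addnS; apply: le_trans IH; apply: step; apply: (le_trans hk0).
  by rewrite ler_nat leq_addr.
move=> k; have := bnd k; rewrite /e exprMn => h.
rewrite exprVn ler_pdivlMr ?exprn_gt0 //; lra.
Qed.

(** Induction on m, with (B-I)_(m+1) = (B-I) (B)_m. *)
Lemma sum_poch_fact B m :
  \sum_(k < m.+1) (k`!%:R : K)^-1 *: mxpoch (B - 1%:M) k =
  (m`!%:R : K)^-1 *: mxpoch B m.
Proof.
elim: m => [|m IH]; first by rewrite big_ord1 !mxpoch0.
rewrite big_ord_recr IH /= (mxpochSl (B - 1%:M)) subrK mxpochS.
have -> : (B - 1%:M) * mxpoch B m = mxpoch B m * (B - 1%:M).
  apply: (@bicomm_comm _ _ B); last by apply: bicomm_poch; exact: bicomm_refl.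
  apply: bicommD; first exact: bicomm_refl.
  by apply: bicommN; exact: bicomm_scalar.
have f0 : (m`!%:R : K) != 0 by rewrite pnatr_eq0 -lt0n fact_gt0.
have m0 : (m.+1%:R : K) != 0 by rewrite pnatr_eq0.
have -> : (m`!%:R : K)^-1 *: mxpoch B m =
    ((m.+1)`!%:R : K)^-1 *: (mxpoch B m * m.+1%:R%:M).
  rewrite -[X in _ * X]scalemx1 -scalerAr mulr1 scalerA factS natrM invfM.
  by rewrite mulrAC mulVf // mul1r.
rewrite -scalerDr -mulrDr; congr (_ *: (_ * _)).
by rewrite -[m.+1]addn1 natmxD addrC addrACA addNr addr0.
Qed.

(** Peeling off one factor turns the ratio for B into the ratio for B + I, which
    is what the induction in sum_poch_ratio needs. *)
Lemma poch_ratioS B k : gamma_regular B ->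
  mxpoch (B - 1%:M) k.+1 * (mxpoch B k.+1)^-1 =
  (B - 1%:M) * B^-1 * (mxpoch B k * (mxpoch (B + 1%:M) k)^-1).
Proof.
move=> hB; have uB : B \is a GRing.unit.
  by have := hB 0%N; rewrite raddf0 addr0.
have up := mxpoch_unit k (gamma_regular1 hB).
have c1 : GRing.comm B^-1 (mxpoch B k).
  by apply: (@bicomm_comm _ _ B); [apply: bicommV|apply: bicomm_poch]; exact: bicomm_refl.
have c2 : GRing.comm B^-1 (mxpoch (B + 1%:M) k)^-1.
  apply: (@bicomm_comm _ _ B); apply: bicommV; first exact: bicomm_refl.
  exact: bicomm_poch_shift.
rewrite (mxpochSl (B - 1%:M)) subrK mxpochSl (invrM uB up) -!mulrA.
suff -> : mxpoch B k * ((mxpoch (B + 1%:M) k)^-1 * B^-1) =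
  B^-1 * (mxpoch B k * (mxpoch (B + 1%:M) k)^-1) by [].
by rewrite [RHS]mulrA c1 -mulrA c2.
Qed.

Lemma alternating_pascal (V : lmodType K) (r : nat -> V) m :
  \sum_(k < m.+2) ((-1) ^+ k * 'C(m.+1, k)%:R : K) *: r k =
  \sum_(k < m.+1) ((-1) ^+ k * 'C(m, k)%:R : K) *: r k
  - \sum_(k < m.+1) ((-1) ^+ k * 'C(m, k)%:R : K) *: r k.+1.
Proof.
rewrite big_ord_recl [X in _ = X - _]big_ord_recl !bin0 -addrA; congr (_ + _).
rewrite -sumrN [X in _ = X + _](_ : _ =
  \sum_(k < m.+1) ((-1) ^+ k.+1 * 'C(m, k.+1)%:R : K) *: r k.+1); last first.
  by rewrite [RHS]big_ord_recr /= bin_small // mulr0 scale0r addr0.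
rewrite -big_split; apply: eq_bigr => k _ /=.
rewrite -scaleNr -scalerDl binS natrD /bump /= !add1n; congr (_ *: _).
by rewrite exprS; ring.
Qed.

(** Chu-Vandermonde: with T_m(B) the left-hand side, Pascal's rule gives
    T_(m+1)(B) = T_m(B) - (B-I) B^-1 T_m(B+I). *)
Lemma sum_poch_ratio B m : gamma_regular B ->
  \sum_(k < m.+1) ((-1) ^+ k * 'C(m, k)%:R : K) *:
    (mxpoch (B - 1%:M) k * (mxpoch B k)^-1) = (m`!%:R : K) *: (mxpoch B m)^-1.
Proof.
elim: m B => [|m IH] B hB.
  by rewrite big_ord1 !mxpoch0 expr0 bin0 fact0 !mul1r invr1.
have hB1 := gamma_regular1 hB.
have uB : B \is a GRing.unit by have := hB 0%N; rewrite raddf0 addr0.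
have uBm : B + m%:R%:M \is a GRing.unit by exact: hB.
apply: (etrans (alternating_pascal (fun k => mxpoch (B - 1%:M) k * (mxpoch B k)^-1) m)).
rewrite [X in X - _ = _](_ : _ = (m`!%:R : K) *: (mxpoch B m)^-1); last exact: (IH B hB).
rewrite (eq_bigr (fun k : 'I_m.+1 => ((B - 1%:M) * B^-1) * (((-1) ^+ k * 'C(m, k)%:R) *:
   (mxpoch (B + 1%:M - 1%:M) k * (mxpoch (B + 1%:M) k)^-1)))); last first.
  by move=> k _; rewrite (poch_ratioS k hB) -scalerAr addrK.
rewrite -mulr_sumr (IH _ hB1) -scalerAr -scalerBr factS mulnC natrM -scalerA.
congr (_ *: _).
have um1 := mxpoch_unit m hB1.
have um := mxpoch_unit m hB.
have E1 : B^-1 * (mxpoch (B + 1%:M) m)^-1 = (mxpoch B m.+1)^-1.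
  rewrite mxpochSl (invrM uB um1); apply: (@bicomm_comm _ _ B); apply: bicommV.
    exact: bicomm_refl.
  exact: bicomm_poch_shift.
have E2 : (mxpoch B m)^-1 = (B + m%:R%:M) * (mxpoch B m.+1)^-1.
  by rewrite mxpochS (invrM um uBm) mulrA (mulrV uBm) mul1r.
rewrite E2 -mulrA E1 -mulrBl.
have -> : B + m%:R%:M - (B - 1%:M) = m.+1%:R%:M.
  by rewrite opprB [B + _]addrC -addrA subrKC -[m.+1]addn1 natmxD.
by rewrite -[X in X * _]scalemx1 -scalerAl mul1r.
Qed.

End Pochhammer.

(** * The two hypergeometric expansions *)

Section Expansions.
Variables (R : realType) (n : nat).
Local Notation K := (cplx R).
Implicit Types (A B C M N : 'M[K]_n.+1) (x c w : K).

(** This is 1F2(I; B, C; w): the numerator (I)_k = k! I cancels the factorial. *)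
Definition hyp1F2 B C w : 'M[K]_n.+1 :=
  lim (series (fun k => w ^+ k *: ((mxpoch B k)^-1 * (mxpoch C k)^-1)) @ \oo).

Lemma hyp0F1_cvg C w : gamma_regular C ->
  series (fun k => (w ^+ k / k`!%:R) *: (mxpoch C k)^-1) @ \oo --> hyp0F1 C w.
Proof.
move=> hC; have [D hD] := mnm_poch_inv hC (nm_ge0 w).
apply: (geo_cvg (@mx_abs_complete R _ _) (D := D)) => k.
apply: le_trans (nm_mnm _) _; apply: le_trans (hD k).
rewrite mnmZ nmM nmV nm_nat nmX; apply: ler_wpM2r; first exact: mnm_ge0.
rewrite ler_piMr ?exprn_ge0 ?nm_ge0 // invf_le1 ?ltr0n ?fact_gt0 //.
by rewrite ler1n fact_gt0.
Qed.

Lemma hyp1F2_bound B C (rho : R) : gamma_regular B -> gamma_regular C -> 0 <= rho ->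
  exists D, forall k, rho ^+ k * (mnm (mxpoch B k)^-1 * mnm (mxpoch C k)^-1)
    <= D * 2^-1 ^+ k.
Proof.
move=> hB hC r0; have [D hD] := mnm_poch_inv hC r0.
have [E hE] := mnm_poch_inv hB (@ler01 R); exists (E * D) => k.
have E0 : 0 <= E.
  by have := hE 0%N; rewrite !expr0 mul1r mulr1; apply: le_trans; exact: mnm_ge0.
rewrite mulrCA -mulrA; apply: ler_pM.
- exact: mnm_ge0.
- by apply: mulr_ge0; [exact: exprn_ge0|exact: mnm_ge0].
- have := hE k; rewrite expr1n mul1r => /le_trans; apply.
  by rewrite ler_piMr // exprn_ile1 // ?invr_ge0 // invf_le1 // ler1n.
- exact: hD.
Qed.

Lemma hyp1F2_cvg B C w : gamma_regular B -> gamma_regular C ->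
  series (fun k => w ^+ k *: ((mxpoch B k)^-1 * (mxpoch C k)^-1)) @ \oo
    --> hyp1F2 B C w.
Proof.
move=> hB hC; have [D hD] := hyp1F2_bound hB hC (nm_ge0 w).
apply: (geo_cvg (@mx_abs_complete R _ _) (D := D)) => k.
apply: le_trans (nm_mnm _) _; apply: le_trans (hD k).
rewrite mnmZ nmX; apply: ler_wpM2l; first by rewrite exprn_ge0 ?nm_ge0.
exact: mnmM.
Qed.

Lemma hyp1F2_sym B C w : GRing.comm B C -> hyp1F2 B C w = hyp1F2 C B w.
Proof.
move=> BC; suff E : (fun k => w ^+ k *: ((mxpoch B k)^-1 * (mxpoch C k)^-1)) =
    fun k => w ^+ k *: ((mxpoch C k)^-1 * (mxpoch B k)^-1).
  exact: (congr1 (fun u : nat -> 'M[K]_n.+1 => lim (series u @ \oo)) E).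
apply/funext => k.
suff -> : (mxpoch B k)^-1 * (mxpoch C k)^-1 = (mxpoch C k)^-1 * (mxpoch B k)^-1 by [].
have h1 : bicomm B (mxpoch B k)^-1.
  by apply: bicommV; apply: bicomm_poch; exact: bicomm_refl.
have h2 : bicomm C (mxpoch C k)^-1.
  by apply: bicommV; apply: bicomm_poch; exact: bicomm_refl.
by apply: h2; apply/commr_sym; apply: h1; apply/commr_sym.
Qed.

Lemma scaler3 (a b c : K) M N :
  a *: ((b *: (c *: M)) * N) = (a * b * c) *: (M * N).
Proof. by rewrite scalerA -scalerAl scalerA mulrA. Qed.

(** Both series of the right-hand side are expanded, with
    (C)_k (C+kI)_m = (C)_(k+m); the antidiagonal sums are given by
    sum_poch_ratio. *)
Lemma hyp1F2_expansion B C w : gamma_regular B -> gamma_regular C ->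
  series (fun k => ((- w) ^+ k / k`!%:R) *:
    (mxpoch (B - 1%:M) k * (mxpoch B k)^-1 * (mxpoch C k)^-1 *
     hyp0F1 (C + k%:R%:M) w)) @ \oo --> hyp1F2 B C w.
Proof.
move=> hB hC.
pose a k m := ((-1) ^+ k * w ^+ (k + m) / (k`!%:R * m`!%:R) : K) *:
  (mxpoch (B - 1%:M) k * (mxpoch B k)^-1 * (mxpoch C (k + m))^-1).
have [rho r1 hP] := mnm_poch (B - 1%:M).
have r0 : 0 <= rho by lra.
have wr0 : 0 <= rho * nm w by apply: mulr_ge0 => //; exact: nm_ge0.
have [D hD] := mnm_poch_inv hC wr0.
have [E hE] := mnm_poch_inv hB (@ler01 R).
have E0 : 0 <= E.
  by have := hE 0%N; rewrite !expr0 mul1r mulr1; apply: le_trans; exact: mnm_ge0.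
have hE' k : mnm (mxpoch B k)^-1 <= E.
  have := hE k; rewrite expr1n mul1r => /le_trans; apply.
  by rewrite ler_piMr // exprn_ile1 // ?invr_ge0 // invf_le1 // ler1n.
set o := mnm (1 : 'M[K]_n.+1) in hP; have o0 : 0 <= o by exact: mnm_ge0.
apply: (double_series (a := a) (D := o * E * D)).
- move=> k m; apply: le_trans (nm_mnm _) _; rewrite /a mnmZ.
  apply: le_trans (_ : nm ((-1) ^+ k * w ^+ (k + m) / (k`!%:R * m`!%:R)) *
    ((o * (k`!%:R * rho ^+ k)) * E * mnm (mxpoch C (k + m))^-1) <= _).
    apply: ler_wpM2l; first exact: nm_ge0.
    apply: le_trans (mnmM _ _) _; apply: ler_wpM2r; first exact: mnm_ge0.
    apply: le_trans (mnmM _ _) _.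
    by apply: ler_pM; [exact: mnm_ge0|exact: mnm_ge0|exact: hP|exact: hE'].
  rewrite -[leRHS]mulrA; apply: le_trans (_ : (o * E) * ((rho * nm w) ^+ (k + m) *
    mnm (mxpoch C (k + m))^-1) <= _); last first.
    by apply: ler_wpM2l (hD (k + m)%N); exact: mulr_ge0.
  rewrite !nmM nmV nmM !nm_nat !nmX nmN nm1 expr1n mul1r exprMn.
  set W := nm w ^+ _; set I := mnm (mxpoch C _)^-1.
  have W0 : 0 <= W by rewrite exprn_ge0 ?nm_ge0.
  have I0 : 0 <= I by exact: mnm_ge0.
  have fk : 0 < (k`!%:R : R) by rewrite ltr0n fact_gt0.
  have fm : 1 <= (m`!%:R : R) by rewrite ler1n fact_gt0.
  have -> : W / (k`!%:R * m`!%:R) * (o * (k`!%:R * rho ^+ k) * E * I) =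
    (o * E * W * I) * (rho ^+ k / m`!%:R).
    by field; rewrite !gt_eqF //; lra.
  have -> : o * E * (rho ^+ (k + m) * W * I) = (o * E * W * I) * rho ^+ (k + m) by ring.
  apply: ler_wpM2l; first by apply: mulr_ge0 => //; apply: mulr_ge0 => //; exact: mulr_ge0.
  apply: le_trans (_ : rho ^+ k <= _).
    by rewrite ler_piMr ?exprn_ge0 // invf_le1 //; lra.
  by rewrite ler_weXn2l // leq_addr.
- move=> k.
  have h := @hyp0F1_cvg (C + k%:R%:M) w (gamma_regularD k hC).
  have := @cvg_series_mulmxl R n (((- w) ^+ k / k`!%:R) *: (mxpoch (B - 1%:M) k *
    (mxpoch B k)^-1 * (mxpoch C k)^-1)) _ _ h.
  rewrite -scalerAl (_ : (fun _ => _ * _) = a k) //; apply/funext => m.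
  rewrite scaler_mulmx /a (mxpoch_invD _ _ hC) !mulrA; congr (_ *: _).
  by rewrite exprD (exprNn w) invfM; ring.
rewrite (_ : (fun m => _) = fun m => w ^+ m *: ((mxpoch B m)^-1 * (mxpoch C m)^-1)).
  exact: hyp1F2_cvg.
apply/funext => m.
have f0 i : (i`!%:R : K) != 0 by rewrite pnatr_eq0 -lt0n fact_gt0.
have -> : (mxpoch B m)^-1 = (m`!%:R : K)^-1 *: (m`!%:R *: (mxpoch B m)^-1).
  by rewrite scalerA mulVf // scale1r.
rewrite -sum_poch_ratio // scaler_sumr mulr_suml scaler_sumr.
apply: eq_bigr => k _; have km : (k <= m)%N by rewrite -ltnS.
rewrite scaler3 /a (subnKC km).
suff -> : (-1) ^+ k * w ^+ m / (k`!%:R * (m - k)`!%:R) =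
  w ^+ m * (m`!%:R)^-1 * ((-1) ^+ k * 'C(m, k)%:R) by [].
rewrite -(bin_fact km) !natrM.
have b0 : ('C(m, k)%:R : K) != 0 by rewrite pnatr_eq0 -lt0n bin_gt0.
by field; rewrite !f0 b0.
Qed.

(** As hyp1F2_expansion, the antidiagonal sums being given by sum_poch_fact;
    here B and C must commute to merge the products based at B and at C. *)
Lemma hyp0F1_expansion B C w : gamma_regular B -> gamma_regular C ->
  GRing.comm B C ->
  series (fun k => (w ^+ k / k`!%:R) *:
    (mxpoch (B - 1%:M) k * (mxpoch B k)^-1 * (mxpoch C k)^-1 *
     hyp1F2 (B + k%:R%:M) (C + k%:R%:M) w)) @ \oo --> hyp0F1 C w.
Proof.
move=> hB hC BC.
pose a k m := (w ^+ (k + m) / k`!%:R : K) *: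
  (mxpoch (B - 1%:M) k * ((mxpoch B (k + m))^-1 * (mxpoch C (k + m))^-1)).
have [rho r1 hP] := mnm_poch (B - 1%:M).
have r0 : 0 <= rho by lra.
have wr0 : 0 <= rho * nm w by apply: mulr_ge0 => //; exact: nm_ge0.
have [D hD] := hyp1F2_bound hB hC wr0.
set o := mnm (1 : 'M[K]_n.+1) in hP; have o0 : 0 <= o by exact: mnm_ge0.
apply: (double_series (a := a) (D := o * D)).
- move=> k m; apply: le_trans (nm_mnm _) _; rewrite /a mnmZ.
  set I := mnm (mxpoch B (k + m))^-1 * mnm (mxpoch C (k + m))^-1.
  have I0 : 0 <= I by apply: mulr_ge0; exact: mnm_ge0.
  apply: le_trans (_ : nm (w ^+ (k + m) / k`!%:R) *
    ((o * (k`!%:R * rho ^+ k)) * I) <= _).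
    apply: ler_wpM2l; first exact: nm_ge0.
    apply: le_trans (mnmM _ _) _.
    by apply: ler_pM; [exact: mnm_ge0|exact: mnm_ge0|exact: hP|exact: mnmM].
  apply: le_trans (_ : o * ((rho * nm w) ^+ (k + m) * I) <= _); last first.
    by rewrite -[leRHS]mulrA; apply: ler_wpM2l (hD (k + m)%N).
  rewrite !nmM nmV !nm_nat !nmX exprMn.
  set W := nm w ^+ _.
  have W0 : 0 <= W by rewrite exprn_ge0 ?nm_ge0.
  have fk : 0 < (k`!%:R : R) by rewrite ltr0n fact_gt0.
  have -> : W / k`!%:R * (o * (k`!%:R * rho ^+ k) * I) = (o * W * I) * rho ^+ k.
    by field; rewrite gt_eqF.
  have -> : o * (rho ^+ (k + m) * W * I) = (o * W * I) * rho ^+ (k + m) by ring.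
  apply: ler_wpM2l; first by apply: mulr_ge0 => //; exact: mulr_ge0.
  by rewrite ler_weXn2l // leq_addr.
- move=> k.
  have h := @hyp1F2_cvg (B + k%:R%:M) (C + k%:R%:M) w (gamma_regularD k hB) (gamma_regularD k hC).
  have := @cvg_series_mulmxl R n ((w ^+ k / k`!%:R) *: (mxpoch (B - 1%:M) k *
    (mxpoch B k)^-1 * (mxpoch C k)^-1)) _ _ h.
  rewrite -scalerAl (_ : (fun _ => _ * _) = a k) //; apply/funext => m.
  rewrite scaler_mulmx /a (mxpoch_invD _ _ hC) (mxpoch_invD _ _ hB) !mulrA.
  have cBC : GRing.comm (mxpoch C k)^-1 (mxpoch (B + k%:R%:M) m)^-1.
    have h1 : bicomm B (mxpoch (B + k%:R%:M) m)^-1 by apply: bicommV; exact: bicomm_poch_shift.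
    have h2 : bicomm C (mxpoch C k)^-1.
      by apply: bicommV; apply: bicomm_poch; exact: bicomm_refl.
    by apply: h1; apply/commr_sym; apply: h2.
  rewrite -[X in _ *: (X * _)]mulrA cBC !mulrA; congr (_ *: _).
  by rewrite exprD; ring.
rewrite (_ : (fun m => _) = fun m => (w ^+ m / m`!%:R) *: (mxpoch C m)^-1).
  exact: hyp0F1_cvg.
apply/funext => m; have um := mxpoch_unit m hB.
have -> : (mxpoch C m)^-1 = mxpoch B m * ((mxpoch B m)^-1 * (mxpoch C m)^-1).
  by rewrite mulrA mulrV // mul1r.
rewrite -scalerA [X in _ = _ *: X]scalerAl -sum_poch_fact mulr_suml scaler_sumr.
apply: eq_bigr => k _; have km : (k <= m)%N by rewrite -ltnS.
by rewrite /a subnKC // -scalerA scalerAl.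
Qed.

End Expansions.

Ltac scalar_shift_tac := let i := fresh in let j := fresh in
  apply/matrixP => i j; rewrite !mxE ?natrB ?natrD ?natrM;
  case: (i == j); rewrite ?mulr1n ?mulr0n; field.

(** lower A and upper A are the two lower parameters of 1F2.  They are locked
    because they differ only in a numeral: telling them apart by conversion would
    compute with complex numbers. *)
HB.lock Definition lower (R : realType) n (A : 'M[cplx R]_n.+1) : 'M[cplx R]_n.+1 :=
  2^-1 *: (A + 1%:M).
HB.lock Definition upper (R : realType) n (A : 'M[cplx R]_n.+1) : 'M[cplx R]_n.+1 :=
  2^-1 *: (A + 2%:M).

(** * Young's function as a hypergeometric function *)

Section YoungBessel.
Variables (R : realType) (n : nat).
Local Notation K := (cplx R).
Implicit Types (A B C M N : 'M[K]_n.+1) (x c w : K).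

Lemma bicomm_hyp0F1 A M w : gamma_regular M -> bicomm A M -> bicomm A (hyp0F1 M w).
Proof.
move=> hM AM; apply: (bicomm_lim _ (@hyp0F1_cvg _ _ M w hM)) => k.
by apply: bicommZ; apply: bicommV; exact: bicomm_poch.
Qed.

Lemma bicomm_hyp1F2 A M N w : gamma_regular M -> gamma_regular N ->
  bicomm A M -> bicomm A N -> bicomm A (hyp1F2 M N w).
Proof.
move=> hM hN AM AN; apply: (bicomm_lim _ (@hyp1F2_cvg _ _ M N w hM hN)) => k.
by apply: bicommZ; apply: bicommM; apply: bicommV; exact: bicomm_poch.
Qed.

Lemma bicomm_lower A : bicomm A (lower A).
Proof. by rewrite lower.unlock; apply: bicommZ; exact: bicomm_shift. Qed.

Lemma bicomm_upper A : bicomm A (upper A).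
Proof. by rewrite upper.unlock; apply: bicommZ; exact: bicomm_shift. Qed.

Lemma lowerD A k : lower (A + (2 * k)%:R%:M) = lower A + k%:R%:M.
Proof. by rewrite lower.unlock; scalar_shift_tac. Qed.

Lemma upperD A k : upper (A + (2 * k)%:R%:M) = upper A + k%:R%:M.
Proof. by rewrite upper.unlock; scalar_shift_tac. Qed.

Lemma lower_double A k : A + 1%:M + (2 * k)%:R%:M = 2 *: (lower A + k%:R%:M).
Proof. by rewrite lower.unlock; scalar_shift_tac. Qed.

Lemma upper_double A k : A + 1%:M + (2 * k).+1%:R%:M = 2 *: (upper A + k%:R%:M).
Proof. by rewrite upper.unlock -[(2 * k).+1]addn1; scalar_shift_tac. Qed.

Lemma gamma_regular_double A : gamma_regular (lower A) -> gamma_regular (upper A) ->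
  gamma_regular (A + 1%:M).
Proof.
move=> hB hC j; have u2 : (2 : K) \is a GRing.unit by rewrite unitfE pnatr_eq0.
have jE : j = (odd j + 2 * j./2)%N by rewrite mul2n odd_double_half.
case: (odd j) jE => ->.
  rewrite add1n upper_double (unitmxZ _ u2); exact: (hC j./2).
rewrite add0n lower_double (unitmxZ _ u2); exact: (hB j./2).
Qed.

(** The even and the odd factors of (A+I)_2k are 2(B+jI) and 2(C+jI). *)
Lemma mxpoch_double A k :
  mxpoch (A + 1%:M) (2 * k) = 4 ^+ k *: (mxpoch (lower A) k * mxpoch (upper A) k).
Proof.
elim: k => [|k IH]; first by rewrite muln0 !mxpoch0 expr0 scale1r mulr1.
rewrite mulnS !mxpochS IH lower_double upper_double.
have cBC : GRing.comm (mxpoch (upper A) k) (lower A + k%:R%:M).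
  apply: (@bicomm_comm _ _ A); first by apply: bicomm_poch; exact: bicomm_upper.
  by apply: bicommD; [exact: bicomm_lower|exact: bicomm_scalar].
have E (p q s t : 'M[K]_n.+1) : GRing.comm q s -> p * q * s * t = p * s * (q * t).
  by move=> qs; rewrite -(mulrA p) qs !mulrA.
rewrite !scaler_mulmx (E _ _ _ _ cBC).
suff -> : (4 ^+ k.+1 : K) = 4 ^+ k * 2 * 2 by [].
by rewrite exprSr; ring.
Qed.

Lemma mxpoch_double_inv A k : gamma_regular (lower A) -> gamma_regular (upper A) ->
  (mxpoch (A + 1%:M) (2 * k))^-1 =
  (4 ^+ k)^-1 *: ((mxpoch (lower A) k)^-1 * (mxpoch (upper A) k)^-1).
Proof.
move=> hB hC; have u1 := mxpoch_unit k hB; have u2 := mxpoch_unit k hC.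
have u4 : (4 ^+ k : K) \is a GRing.unit by rewrite unitfE expf_neq0 // pnatr_eq0.
have u12 : mxpoch (lower A) k * mxpoch (upper A) k \is a GRing.unit.
  by rewrite (unitrMl _ u2); exact: u1.
rewrite mxpoch_double (invrZ u4 u12) (invrM u1 u2).
have E : GRing.comm (mxpoch (upper A) k)^-1 (mxpoch (lower A) k)^-1; last first.
  by rewrite E; exact: erefl.
by apply: (@bicomm_comm _ _ A); apply: bicommV; apply: bicomm_poch;
  [exact: bicomm_upper|exact: bicomm_lower].
Qed.

Lemma mxrGamma_poch M m : gamma_regular M ->
  mxrGamma (M + m%:R%:M) = (mxpoch M m)^-1 * mxrGamma M.
Proof.
move=> hM; elim: m => [|m IH].
  by rewrite mxpoch0 invr1 mul1r raddf0 addr0.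
rewrite mxpochS (invrM (mxpoch_unit m hM) (hM m)) -mulrA -IH.
rewrite [mxrGamma (M + m%:R%:M)]mxrGamma_rec mulrA (mulVr (hM m)) mul1r.
by rewrite -[m.+1]addn1 natmxD addrA.
Qed.

Lemma scalar_assoc (a b : K) M N : a *: ((b *: M) * N) = (a * b) *: M * N.
Proof. by rewrite -[(b *: M) * N]scalerAl scalerA scalerAl. Qed.

(** rGamma(A + (2k+1)I) = [(A+I)_2k]^-1 rGamma(A+I), and the powers of 4 turn
    (-1)^k x^2k into w^k. *)
Lemma youngE A x : gamma_regular (lower A) -> gamma_regular (upper A) ->
  young A x = mxpow x A * (hyp1F2 (lower A) (upper A) (- (x ^+ 2 / 4)) *
    mxrGamma (A + 1%:M)).
Proof.
move=> hB hC; have hA := gamma_regular_double hB hC.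
set B := lower A in hB *; set C := upper A in hC *.
have h0 := @hyp1F2_cvg _ _ _ _ (- (x ^+ 2 / 4)) hB hC.
have h := @cvg_series_mulmxr R n (mxrGamma (A + 1%:M)) _ _ h0.
suff E : (fun k => ((-1) ^+ k * x ^+ (2 * k)) *: mxrGamma (A + (2 * k + 1)%:R%:M)) =
    fun k => ((- (x ^+ 2 / 4)) ^+ k *: ((mxpoch B k)^-1 * (mxpoch C k)^-1)) *
      mxrGamma (A + 1%:M).
  rewrite /young E.
  suff -> : lim (series (fun k => ((- (x ^+ 2 / 4)) ^+ k *:
    ((mxpoch B k)^-1 * (mxpoch C k)^-1)) * mxrGamma (A + 1%:M)) @ \oo) =
    hyp1F2 B C (- (x ^+ 2 / 4)) * mxrGamma (A + 1%:M) by [].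
  by apply: cvg_lim; [exact: norm_hausdorff|exact: h].
apply/funext => k.
have -> : A + (2 * k + 1)%:R%:M = (A + 1%:M) + (2 * k)%:R%:M.
  by rewrite natmxD [_ + 1%:R%:M]addrC addrA.
rewrite (mxrGamma_poch _ hA) (mxpoch_double_inv _ hB hC) -/B -/C.
set Q := (mxpoch B k)^-1 * (mxpoch C k)^-1; set G := mxrGamma _.
rewrite scalar_assoc.
suff -> : (-1) ^+ k * x ^+ (2 * k) * (4 ^+ k)^-1 = (- (x ^+ 2 / 4)) ^+ k by [].
by rewrite (exprNn (x ^+ 2 / 4)) exprMn exprVn -exprM mulrA.
Qed.

End YoungBessel.

Ltac bicomm_tac := lazymatch goal with
  | |- bicomm ?A ?A => exact: bicomm_refl
  | |- bicomm _ (lower _) => exact: bicomm_lower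
  | |- bicomm _ (upper _) => exact: bicomm_upper
  | |- bicomm _ (_%:M) => exact: bicomm_scalar
  | |- bicomm _ (_ + _) => apply: bicommD; bicomm_tac
  | |- bicomm _ (- _) => apply: bicommN; bicomm_tac
  | |- bicomm _ (_ * _) => apply: bicommM; bicomm_tac
  | |- bicomm _ (_ *: _) => apply: bicommZ; bicomm_tac
  | |- bicomm _ (_^-1) => apply: bicommV; bicomm_tac
  | |- bicomm _ (mxpoch _ _) => apply: bicomm_poch; bicomm_tac
  | |- bicomm _ (mxpow _ _) => apply: bicomm_mxpow; bicomm_tac
  | |- bicomm _ (mxrGamma _) => apply: bicomm_mxfun; bicomm_tac
  | |- bicomm _ (mxGamma _) => apply: bicomm_mxfun; bicomm_tac
  | |- _ => idtac
  end.

(** * The terms of the four series *)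

Section TermShapes.
Variables (K : fieldType) (n : nat).
Variables a b c d e f g h Y q r : 'M[K]_n.+1.
Variables k1 s t v : K.
Hypothesis comm8 : {in [:: a; b; c; d; e; f; g; h] &, forall M N, GRing.comm M N}.

Lemma collect_scalars p p' :
  k1 *: ((s *: Y) * d * 1 * (p * (t *: (q * r)) * p')) =
  (Y * d) * ((k1 * s * t) *: (p * q * r * p')).
Proof. by rewrite mulr1 -scalerAr -!scalerAl -!scalerAr !scalerA !mulrA. Qed.

(** Stated for arbitrary matrices so that each series is handled by one unification
    instead of a chain of rewriting steps among large terms. *)
Lemma term_shape1 : a * g = s *: Y -> f * e = 1 -> c = t *: (q * r) ->
  k1 * s * t = v ->
  k1 *: (a * b * c * d * e * (f * g * h)) = (Y * d) * (v *: (b * q * r * h)).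
Proof. by move=> ag fe cE <-; rewrite regroup1 // ag fe cE collect_scalars. Qed.

Lemma term_shape2 : c * g = s *: Y -> f * e = 1 -> b = t *: (q * r) ->
  k1 * s * t = v ->
  k1 *: (a * b * c * d * e * (f * g * h)) = (Y * d) * (v *: (a * q * r * h)).
Proof. by move=> cg fe bE <-; rewrite regroup2 // cg fe bE collect_scalars. Qed.

Lemma term_shape3 : a * f = s *: Y -> h * e = 1 -> c = t *: (q * r) ->
  k1 * s * t = v ->
  k1 *: (a * b * c * d * e * (f * (g * h))) = (Y * d) * (v *: (b * q * r * g)).
Proof. by move=> af he cE <-; rewrite regroup3 // af he cE collect_scalars. Qed.

Lemma term_shape4 : b * f = s *: Y -> h * e = 1 -> c = t *: (q * r) ->
  k1 * s * t = v ->
  k1 *: (a * b * c * d * e * (f * (g * h))) = (Y * d) * (v *: (a * q * r * g)).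
Proof. by move=> bf he cE <-; rewrite regroup4 // bf he cE collect_scalars. Qed.

End TermShapes.

Section Relations.
Variables (R : realType) (n : nat).
Local Notation K := (cplx R).
Variables (A : 'M[K]_n.+1) (x : K).
Hypotheses (hB : gamma_regular (lower A)) (hC : gamma_regular (upper A)).
Hypothesis x0 : x != 0.

Local Notation B := (lower A).
Local Notation C := (upper A).
Local Notation w := (- (x ^+ 2 / 4) : K).

Lemma bicomm8 (a b c d e f g h : 'M[K]_n.+1) :
  bicomm A a -> bicomm A b -> bicomm A c -> bicomm A d ->
  bicomm A e -> bicomm A f -> bicomm A g -> bicomm A h ->
  {in [:: a; b; c; d; e; f; g; h] &, forall M N, GRing.comm M N}.
Proof.
move=> ha hb hc hd he hf hg hh; apply: (@bicomm_in _ _ A) => M.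
rewrite !inE => /or4P[/eqP->|/eqP->|/eqP->|] //.
by case/or4P => [/eqP->|/eqP->|/eqP->|/orP[/eqP->|/eqP->]].
Qed.

Lemma twice_neq0 : 2 * x != 0.
Proof. by rewrite mulf_neq0 // pnatr_eq0. Qed.

Lemma half_neq0 : x / 2 != 0.
Proof. by rewrite mulf_neq0 // invr_eq0 pnatr_eq0. Qed.

Lemma scale_half M : 2 *: (2^-1 *: M) = M :> 'M[K]_n.+1.
Proof. by rewrite scalerA mulfV ?scale1r // pnatr_eq0. Qed.

Lemma powers_term1 k :
  mxpow (2 * x) (2^-1 *: (A + (2 * k)%:R%:M)) *
    mxpow (x / 2) (2^-1 *: (A + (2 * k)%:R%:M)) = x ^+ (2 * k) *: mxpow x A.
Proof. by rewrite (mxpow_double _ x0) scale_half (mxpow_nat _ _ x0). Qed.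

Lemma powers_term2 k :
  mxpow (2 * x) (2^-1 *: (A + ((2 * k)%:R - 1)%:M) + 1%:M) *
    mxpow (x / 2) (2^-1 *: (A + ((2 * k)%:R - 1)%:M)) =
  (2 * x ^+ (2 * k)) *: mxpow x A.
Proof.
rewrite (mxpowS _ twice_neq0) -scalerAl (mxpow_double _ x0) scale_half -2!scalerA.
by rewrite -(mxpowS _ x0) -addrA -raddfD subrK (mxpow_nat _ _ x0).
Qed.

Lemma powers_term3 k : mxpow (2 * x) (- (2^-1 *: A)) * mxpow x (A + (2 * k)%:R%:M) =
  x ^+ (2 * k) *: mxpow (x / 2) (2^-1 *: A).
Proof.
rewrite (mxpow_nat _ _ x0) -scalerAr -{2}[A]scale_half -(mxpow_double _ x0).
by rewrite mulrA mxpowN mul1r.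
Qed.

(** With N = (A+I)/2 one has x x^A = (2x)^N (x/2)^N, and the last factor is
    (x/2) (x/2)^(N-I); cancelling x leaves the factor 1/2. *)
Lemma powers_term4 k : mxpow (2 * x) (- (2^-1 *: (A + 1%:M))) * mxpow x (A + (2 * k)%:R%:M) =
  (2^-1 * x ^+ (2 * k)) *: mxpow (x / 2) (2^-1 *: (A - 1%:M)).
Proof.
set N := 2^-1 *: (A + 1%:M); set N' := 2^-1 *: (A - 1%:M).
have NN : N = N' + 1%:M by rewrite /N /N'; scalar_shift_tac.
have E : mxpow x A = 2^-1 *: (mxpow (2 * x) N * mxpow (x / 2) N').
  have -> : mxpow x A = x^-1 *: (x *: mxpow x A) by rewrite scalerA mulVf // scale1r.
  have -> : x *: mxpow x A = x *: (2^-1 *: (mxpow (2 * x) N * mxpow (x / 2) N')).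
    rewrite -(mxpowS _ x0) -[A + 1%:M]scale_half -/N -(mxpow_double _ x0).
    by rewrite {2}NN (mxpowS _ half_neq0) -scalerAr scalerA.
  by rewrite [LHS]scalerA mulVf // scale1r.
rewrite (mxpow_nat _ _ x0) E -!scalerAr mulrA mxpowN mul1r scalerA.
by rewrite [_ * 2^-1]mulrC.
Qed.

Lemma lower_pred : 2^-1 *: (A - 1%:M) = B - 1%:M.
Proof. by rewrite lower.unlock; scalar_shift_tac. Qed.

Lemma upper_pred : 2^-1 *: A = C - 1%:M.
Proof. by rewrite upper.unlock; scalar_shift_tac. Qed.

Lemma upper_arg k : 2^-1 *: (A + (2 * k + 2)%:R%:M) = C + k%:R%:M.
Proof. by rewrite upper.unlock; scalar_shift_tac. Qed.

Lemma upper_arg1 k : 2^-1 *: (A + (2 * k)%:R%:M) + 1%:M = C + k%:R%:M.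
Proof. by rewrite upper.unlock; scalar_shift_tac. Qed.

Lemma lower_arg k : 2^-1 *: (A + (2 * k + 1)%:R%:M) = B + k%:R%:M.
Proof. by rewrite lower.unlock; scalar_shift_tac. Qed.

Lemma lower_arg1 k : 2^-1 *: (A + ((2 * k)%:R - 1)%:M) + 1%:M = B + k%:R%:M.
Proof. by rewrite lower.unlock; scalar_shift_tac. Qed.

Lemma coef_term1 k : (k`!%:R : K)^-1 * x ^+ (2 * k) * (4 ^+ k)^-1 = (- w) ^+ k / k`!%:R.
Proof. by rewrite opprK exprMn exprVn -exprM -mulrA mulrC. Qed.

Lemma coef_term3 k : (-1) ^+ k / k`!%:R * x ^+ (2 * k) * (4 ^+ k)^-1 = w ^+ k / k`!%:R.
Proof. by rewrite (exprNn (x ^+ 2 / 4)) exprMn exprVn -exprM; ring. Qed.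

Lemma mxpoch_double_inv_sym k : (mxpoch (A + 1%:M) (2 * k))^-1 =
  (4 ^+ k)^-1 *: ((mxpoch C k)^-1 * (mxpoch B k)^-1).
Proof.
have E : GRing.comm (mxpoch C k)^-1 (mxpoch B k)^-1; last first.
  by rewrite E; exact: mxpoch_double_inv.
by apply: (@bicomm_comm _ _ A); apply: bicommV; apply: bicomm_poch;
  [exact: bicomm_upper|exact: bicomm_lower].
Qed.

Lemma term1 k :
  (k`!%:R)^-1 *:
    (mxpow (2 * x) (2^-1 *: (A + (2 * k)%:R%:M))
     * mxpoch (2^-1 *: (A - 1%:M)) k
     * (mxpoch (A + 1%:M) (2 * k))^-1
     * mxrGamma (A + 1%:M)
     * mxGamma (2^-1 *: (A + (2 * k + 2)%:R%:M))
     * bessel (2^-1 *: (A + (2 * k)%:R%:M)) x) =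
  (mxpow x A * mxrGamma (A + 1%:M)) *
  (((- w) ^+ k / k`!%:R) *: (mxpoch (B - 1%:M) k * (mxpoch B k)^-1 *
    (mxpoch C k)^-1 * hyp0F1 (C + k%:R%:M) w)).
Proof.
have -> : bessel (2^-1 *: (A + (2 * k)%:R%:M)) x = mxrGamma (C + k%:R%:M) *
    mxpow (x / 2) (2^-1 *: (A + (2 * k)%:R%:M)) * hyp0F1 (C + k%:R%:M) w.
  by rewrite /bessel upper_arg1.
rewrite upper_arg lower_pred; apply: (term_shape1 _ (powers_term1 k)
  (mxrGammaK (gamma_regularD k hC)) (mxpoch_double_inv k hB hC) (coef_term1 k)).
  apply: bicomm8; bicomm_tac.
  apply: bicomm_hyp0F1; first exact: gamma_regularD.
  by bicomm_tac.
Qed.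

Lemma term2 k :
  2^-1 *: ((k`!%:R)^-1 *:
    (mxpoch (2^-1 *: A) k
     * (mxpoch (A + 1%:M) (2 * k))^-1
     * mxpow (2 * x) (2^-1 *: (A + (2 * k + 1)%:R%:M))
     * mxrGamma (A + 1%:M)
     * mxGamma (2^-1 *: (A + (2 * k + 1)%:R%:M))
     * bessel (2^-1 *: (A + ((2 * k)%:R - 1)%:M)) x)) =
  (mxpow x A * mxrGamma (A + 1%:M)) *
  (((- w) ^+ k / k`!%:R) *: (mxpoch (C - 1%:M) k * (mxpoch C k)^-1 *
    (mxpoch B k)^-1 * hyp0F1 (B + k%:R%:M) w)).
Proof.
have -> : bessel (2^-1 *: (A + ((2 * k)%:R - 1)%:M)) x = mxrGamma (B + k%:R%:M) *
    mxpow (x / 2) (2^-1 *: (A + ((2 * k)%:R - 1)%:M)) * hyp0F1 (B + k%:R%:M) w.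
  by rewrite /bessel lower_arg1.
have scal : 2^-1 / k`!%:R * (2 * x ^+ (2 * k)) / 4 ^+ k = (- w) ^+ k / k`!%:R.
  rewrite -coef_term1; congr (_ / _).
  by rewrite mulrCA !mulrA mulfV ?mul1r // pnatr_eq0.
rewrite scalerA upper_pred lower_arg.
have pw := powers_term2 k; rewrite lower_arg1 in pw.
apply: (term_shape2 _ pw
  (mxrGammaK (gamma_regularD k hB)) (mxpoch_double_inv_sym k) scal).
  apply: bicomm8; bicomm_tac.
  apply: bicomm_hyp0F1; first exact: gamma_regularD.
  by bicomm_tac.
Qed.

Lemma young_shift k : young (A + (2 * k)%:R%:M) x =
  mxpow x (A + (2 * k)%:R%:M) *
  (hyp1F2 (B + k%:R%:M) (C + k%:R%:M) w * mxrGamma (A + (2 * k + 1)%:R%:M)).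
Proof.
rewrite youngE ?lowerD ?upperD; [|exact: gamma_regularD|exact: gamma_regularD].
by rewrite -addrA -[1%:M]/(1%:R%:M) -natmxD.
Qed.

Lemma regular_odd k : gamma_regular (A + (2 * k + 1)%:R%:M).
Proof.
have -> : A + (2 * k + 1)%:R%:M = A + 1%:M + (2 * k)%:R%:M.
  by rewrite natmxD [_ + 1%:R%:M]addrC addrA.
by apply: gamma_regularD; exact: gamma_regular_double.
Qed.

Lemma term3 k :
  ((-1) ^+ k / k`!%:R) *:
    (mxpow (2 * x) (- (2^-1 *: A))
     * mxpoch (2^-1 *: (A - 1%:M)) k
     * (mxpoch (A + 1%:M) (2 * k))^-1
     * mxrGamma (2^-1 *: (A + 2%:M))
     * mxGamma (A + (2 * k + 1)%:R%:M)
     * young (A + (2 * k)%:R%:M) x) =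
  (mxpow (x / 2) (2^-1 *: A) * mxrGamma C) *
  ((w ^+ k / k`!%:R) *: (mxpoch (B - 1%:M) k * (mxpoch B k)^-1 *
    (mxpoch C k)^-1 * hyp1F2 (B + k%:R%:M) (C + k%:R%:M) w)).
Proof.
have -> : 2^-1 *: (A + 2%:M) = C by rewrite upper.unlock.
rewrite young_shift lower_pred; apply: (term_shape3 _ (powers_term3 k)
  (mxrGammaK (regular_odd k)) (mxpoch_double_inv k hB hC) (coef_term3 k)).
  apply: bicomm8; bicomm_tac.
  apply: bicomm_hyp1F2; [exact: gamma_regularD|exact: gamma_regularD| |];
    by bicomm_tac.
Qed.

Lemma term4 k :
  2 *: (((-1) ^+ k / k`!%:R) *:
    (mxpoch (2^-1 *: A) k
     * mxpow (2 * x) (- (2^-1 *: (A + 1%:M)))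
     * (mxpoch (A + 1%:M) (2 * k))^-1
     * mxrGamma (2^-1 *: (A + 1%:M))
     * mxGamma (A + (2 * k + 1)%:R%:M)
     * young (A + (2 * k)%:R%:M) x)) =
  (mxpow (x / 2) (2^-1 *: (A - 1%:M)) * mxrGamma B) *
  ((w ^+ k / k`!%:R) *: (mxpoch (C - 1%:M) k * (mxpoch C k)^-1 *
    (mxpoch B k)^-1 * hyp1F2 (C + k%:R%:M) (B + k%:R%:M) w)).
Proof.
have sym : hyp1F2 (B + k%:R%:M) (C + k%:R%:M) w = hyp1F2 (C + k%:R%:M) (B + k%:R%:M) w.
  apply: hyp1F2_sym; apply: (@bicomm_comm _ _ A); bicomm_tac.
have eB : 2^-1 *: (A + 1%:M) = B by rewrite lower.unlock.
have scal : 2 * ((-1) ^+ k / k`!%:R) * (2^-1 * x ^+ (2 * k)) / 4 ^+ k = w ^+ k / k`!%:R.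
  rewrite -coef_term3; congr (_ / _); rewrite mulrACA mulfV ?mul1r ?pnatr_eq0 //.
have pw := powers_term4 k; rewrite eB in pw.
rewrite young_shift scalerA upper_pred eB sym; apply: (term_shape4 _ pw
  (mxrGammaK (regular_odd k)) (mxpoch_double_inv_sym k) scal).
  apply: bicomm8; bicomm_tac.
  apply: bicomm_hyp1F2; [exact: gamma_regularD|exact: gamma_regularD| |];
    by bicomm_tac.
Qed.

Lemma cvg_terms (c : K) (u v : nat -> 'M[K]_n.+1) (Y l l' : 'M[K]_n.+1) :
  (forall k, c *: u k = Y * v k) -> series v @ \oo --> l -> Y * l = l' ->
  c *: series u m @[m --> \oo] --> l'.
Proof.
move=> uv vl <-; have h := @cvg_series_mulmxl R n Y _ _ vl.
rewrite (_ : (fun m => _) = series (fun k => Y * v k)); first exact: h.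
by apply/funext => m; rewrite /series /= scaler_sumr; apply: eq_bigr => k _.
Qed.

Lemma comm_hyp1F2_rGamma :
  GRing.comm (mxrGamma (A + 1%:M)) (hyp1F2 B C w).
Proof.
apply: (@bicomm_comm _ _ A); first by bicomm_tac.
by apply: bicomm_hyp1F2 => //; [exact: bicomm_lower|exact: bicomm_upper].
Qed.

Lemma comm_lower_upper : GRing.comm B C.
Proof. by apply: (@bicomm_comm _ _ A); [exact: bicomm_lower|exact: bicomm_upper]. Qed.

Lemma bessel_upper : mxpow (x / 2) (2^-1 *: A) * mxrGamma C * hyp0F1 C w =
  bessel (2^-1 *: A) x.
Proof.
have -> : 2^-1 *: A = C - 1%:M by exact: upper_pred.
rewrite /bessel subrK.
apply: (congr1 (fun M => M * hyp0F1 C w)).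
by apply: (@bicomm_comm _ _ C); bicomm_tac.
Qed.

Lemma bessel_lower : mxpow (x / 2) (2^-1 *: (A - 1%:M)) * mxrGamma B * hyp0F1 B w =
  bessel (2^-1 *: (A - 1%:M)) x.
Proof.
rewrite lower_pred /bessel subrK.
apply: (congr1 (fun M => M * hyp0F1 B w)).
by apply: (@bicomm_comm _ _ B); bicomm_tac.
Qed.

End Relations.

(* Two misprints of the source are corrected, as the printed formulas are false
   already for n = 0: the first relation is printed with a further factor
   x^(2k), and the fourth with (2x)^(-A/2) instead of (2x)^(-(A+I)/2). *)
Theorem theorem4p12 (R : realType) (n : nat) (A : 'M[cplx R]_n.+1)
  (hA1 : forall s : nat, 2^-1 *: (A + 1%:M) + s%:R%:M \in unitmx)
  (hA2 : forall s : nat, 2^-1 *: (A + 2%:M) + s%:R%:M \in unitmx)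
  (x : cplx R) (hx : x != 0) :
  [/\ series (fun k : nat =>
        (k`!%:R)^-1 *:
          (mxpow (2 * x) (2^-1 *: (A + (2 * k)%:R%:M))
           * mxpoch (2^-1 *: (A - 1%:M)) k
           * (mxpoch (A + 1%:M) (2 * k))^-1
           * mxrGamma (A + 1%:M)
           * mxGamma (2^-1 *: (A + (2 * k + 2)%:R%:M))
           * bessel (2^-1 *: (A + (2 * k)%:R%:M)) x)) @ \oo --> young A x,
      2^-1 *: series (fun k : nat =>
        (k`!%:R)^-1 *:
          (mxpoch (2^-1 *: A) k
           * (mxpoch (A + 1%:M) (2 * k))^-1
           * mxpow (2 * x) (2^-1 *: (A + (2 * k + 1)%:R%:M))
           * mxrGamma (A + 1%:M)
           * mxGamma (2^-1 *: (A + (2 * k + 1)%:R%:M))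
           * bessel (2^-1 *: (A + ((2 * k)%:R - 1)%:M)) x)) m
        @[m --> \oo] --> young A x,
      series (fun k : nat =>
        ((-1) ^+ k / k`!%:R) *:
          (mxpow (2 * x) (- (2^-1 *: A))
           * mxpoch (2^-1 *: (A - 1%:M)) k
           * (mxpoch (A + 1%:M) (2 * k))^-1
           * mxrGamma (2^-1 *: (A + 2%:M))
           * mxGamma (A + (2 * k + 1)%:R%:M)
           * young (A + (2 * k)%:R%:M) x)) @ \oo --> bessel (2^-1 *: A) x
    & 2 *: series (fun k : nat =>
        ((-1) ^+ k / k`!%:R) *:
          (mxpoch (2^-1 *: A) k
           * mxpow (2 * x) (- (2^-1 *: (A + 1%:M)))
           * (mxpoch (A + 1%:M) (2 * k))^-1
           * mxrGamma (2^-1 *: (A + 1%:M))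
           * mxGamma (A + (2 * k + 1)%:R%:M)
           * young (A + (2 * k)%:R%:M) x)) m
        @[m --> \oo] --> bessel (2^-1 *: (A - 1%:M)) x].
Proof.
have hB : gamma_regular (lower A) by rewrite lower.unlock; exact: hA1.
have hC : gamma_regular (upper A) by rewrite upper.unlock; exact: hA2.
pose w : cplx R := - (x ^+ 2 / 4).
have youngA : mxpow x A * mxrGamma (A + 1%:M) * hyp1F2 (lower A) (upper A) w = young A x.
  by rewrite (youngE _ hB hC) -mulrA (comm_hyp1F2_rGamma x hB hC).
have cBC := comm_lower_upper A; have cCB := commr_sym cBC.
have h1 := @hyp1F2_expansion _ _ _ _ w hB hC.
have h2 := @hyp1F2_expansion _ _ _ _ w hC hB.
have h3 := @hyp0F1_expansion _ _ _ _ w hB hC cBC.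
have h4 := @hyp0F1_expansion _ _ _ _ w hC hB cCB.
split.
- rewrite (funext (term1 hB hC hx)) -youngA.
  exact: (@cvg_series_mulmxl R n _ _ _ h1).
- apply: (cvg_terms (term2 hB hC hx) h2).
  by rewrite -(hyp1F2_sym w cBC).
- rewrite (funext (term3 hB hC hx)) -bessel_upper.
  exact: (@cvg_series_mulmxl R n _ _ _ h3).
- apply: (cvg_terms (term4 hB hC hx) h4).
  exact: bessel_lower.
Qed.
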